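(* Let $\varphi$ be a non-constant entire function of exponential type with $\varphi(0)=0$, and let $\varphi(D)$ be the associated convolution operator on $H(\mathbb{C})$. Let $\lambda,b\in\mathbb{C}$ and let $C_{\lambda,b}:H(\mathbb{C})\to H(\mathbb{C})$ be the composition operator $(C_{\lambda,b}f)(z)=f(\lambda z+b)$. If $|\lambda|\geq 1$, then the operator $L_{\lambda,b,\varphi}=C_{\lambda,b}\circ\varphi(D)$ is hypercyclic on $H(\mathbb{C})$.
   Context: $H(\mathbb{C})$ is the space of all entire functions with the topology of uniform convergence on compact sets (a separable Fréchet space), and $D:f\mapsto f'$ is the derivative operator on it. For an entire function $\varphi(z)=\sum_{k=0}^\infty w_kz^k$ of exponential type, $\varphi(D)=\sum_{k=0}^\infty w_kD^k$, which is a continuous linear operator on $H(\mathbb{C})$ commuting with all translations (a convolution operator). A continuous linear operator $T$ on a Fréchet space $\mathcal{F}$ is hypercyclic if there is $f\in\mathcal{F}$ whose orbit $\{T^nf:n\in\mathbb{N}\}$ is dense in $\mathcal{F}$. *)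

(* Defs.v *)
From mathcomp Require Import all_boot all_order all_algebra.
From mathcomp Require Import all_classical all_reals all_analysis.
From mathcomp Require Import complex.

Set Implicit Arguments.
Unset Strict Implicit.
Unset Printing Implicit Defensive.

Import Order.TTheory GRing.Theory Num.Theory.
Import numFieldNormedType.Exports.

Local Open Scope classical_set_scope.
Local Open Scope ring_scope.

(* The alias [^o] is what carries the norm, the topology and the R[i]-module
   structure; the scalar field being R[i] itself, [derivable] and [derive1n]
   below are complex differentiability and complex derivatives. *)
Notation Cplx R := (R[i]^o) (only parsing).

(* C -> C with the topology of uniform convergence on compact sets. *)
Notation compact_conv R := {family compact, Cplx R -> Cplx R}.

Definition entire (R : realType) : set (Cplx R -> Cplx R) :=
  [set f | forall z : Cplx R, derivable f z 1].

(* Norms on [Cplx R] are [R[i]]-valued (with zero imaginary part). *)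
Definition exponential_type (R : realType) (phi : Cplx R -> Cplx R) : Prop :=
  exists A B : R, forall z : Cplx R,
    `|phi z| <= (A * expR (B * complex.Re `|z|))%:C%C.

Definition taylor_coef (R : realType) (phi : Cplx R -> Cplx R) (k : nat) :
    Cplx R :=
  derive1n k phi 0 / k`!%:R.

(* phi(D) f = \sum_k w_k D^k f, the w_k being the Taylor coefficients of phi
   at 0. *)
Definition convolution_op (R : realType) (phi : Cplx R -> Cplx R)
    (f : Cplx R -> Cplx R) : Cplx R -> Cplx R :=
  fun z => limn (series (fun k => taylor_coef phi k * derive1n k f z)).

Definition composition_op (R : realType) (lambda b : Cplx R)
    (f : Cplx R -> Cplx R) : Cplx R -> Cplx R :=
  fun z => f (lambda * z + b).

Definition L_op (R : realType) (lambda b : Cplx R) (phi : Cplx R -> Cplx R) :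
    (Cplx R -> Cplx R) -> (Cplx R -> Cplx R) :=
  composition_op lambda b \o convolution_op phi.

(* Operators are total on all functions C -> C; this says that T restricts to a
   continuous linear operator on H(C), the subspace [entire R] of
   [compact_conv R]. *)
Record continuous_linear_op (R : realType)
    (T : (Cplx R -> Cplx R) -> (Cplx R -> Cplx R)) : Prop := {
  op_entire : forall f, entire f -> entire (T f) ;
  op_linear : forall (a : R[i]) f g, entire f -> entire g ->
    T (a *: f + g) = a *: T f + T g ;
  op_continuous :
    {within (@entire R : set (compact_conv R)),
      continuous (T : compact_conv R -> compact_conv R)} }.

Definition op_orbit (X : Type) (T : X -> X) (x : X) : set X :=
  range (fun n => iter n T x).

(* The orbit lies in [entire R], so the inclusion says it is dense there. *)
Definition hypercyclic (R : realType)
    (T : (Cplx R -> Cplx R) -> (Cplx R -> Cplx R)) : Prop :=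
  continuous_linear_op T /\
  exists2 f, entire f &
    @entire R `<=` closure (op_orbit T f : set (compact_conv R)).

(* Main.v *)
Require Import Defs.
From mathcomp Require Import all_boot all_order all_algebra.
From mathcomp Require Import all_classical all_reals all_analysis.
From mathcomp Require Import complex.
From mathcomp Require Import ring lra.
Import Order.TTheory GRing.Theory Num.Theory.
Import numFieldNormedType.Exports.
Local Open Scope classical_set_scope.
Local Open Scope ring_scope.
Import ComplexField.Normc.

Set Implicit Arguments.
Unset Strict Implicit.
Unset Printing Implicit Defensive.

(** Write phi(D) = w_m D^m + w_(m+1) D^(m+1) + ... with w_m != 0 and m >= 1
    (phi is not constant and vanishes at 0), and let L be the operator
    f |-> (phi(D) f)(lambda z + b).  The proof is a hypercyclicity criterion
    carried out by hand on polynomials.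

    L lowers the degree of a polynomial by at least m, so the orbit of every
    polynomial reaches 0 (iterL_poly_eq0).  In the other direction, look for
    q_n with L^n q_n = p, where p has size at most N, among the combinations of
    z^r / r! with m n <= r < m n + N.  Going back one step means solving
    L X = Y up to terms of degree < s, where Y lives in the degrees
    [s, s + N[; these lower terms are harmless because they are killed by the
    remaining iterations of L.  On the sequences of derivatives at 0 this is a
    triangular Toeplitz system of fixed size, the same for all s, except that the
    u-th equation carries a factor lambda^u; dividing by it does not increase the
    right-hand side because |lambda| >= 1 (right_inverse_step).  Hence the
    coordinates of q_n grow at most like M^n, while z^r / r! is of order
    1 / (m n)! on compact sets, and q_n tends to 0 (epoly_small).

    The hypercyclic vector is then a series f = sum q_j in which q_j is a small
    preimage, under L^(n_j), of the j-th member of a list of polynomials with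
    coefficients in Q(i) where each one recurs infinitely often
    (poly_sequence).  The n_j grow so fast that L^(n_j) kills q_i for i < j and
    that L^(n_i) q_j is tiny for i < j, so L^(n_i) f is close to the i-th
    member of the list (hypercyclic_vector).

    For this to make sense on entire functions, one needs that L is well defined
    and continuous.  With |w_k| <= A C^k / k! (from the exponential type) and
    |f^(k)(z)| <= (8 k / delta)^k sup_(|y - z| <= delta) |f|, the series
    phi(D) f converges geometrically once delta is large, locally uniformly in z
    (convop_approx).  All the complex analysis that is used comes from one
    result, cauchy_expansion: Taylor expansion with Cauchy estimates up to
    constants.  It is obtained from the theorem of Goursat on rectangles and the
    geometric expansion of 1 / (z - w) on the boundary of a square; Weierstrass'
    theorem on locally uniform limits, the analyticity of derivatives and the
    density of polynomials follow from it. *)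

(** * Modulus and complex derivative *)

(** The modulus [normc] is real-valued, while the norm of [Cplx R] takes values in
    the complex numbers; the estimates below are all made with [normc]. *)
Lemma normcD (R : realType) (x y : R[i]) : normc (x + y) <= normc x + normc y.
Proof. exact: (@le_normcD R x y). Qed.

Lemma normc_opp (R : realType) (x : R[i]) : normc (- x) = normc x.
Proof. exact: (@normcN R x). Qed.

Lemma normc_ge0 (R : realType) (z : R[i]) : 0 <= normc z.
Proof. by case: z => x y /=; exact: sqrtr_ge0. Qed.

Lemma normc_gt0 (R : realType) (z : R[i]) : (0 < normc z) = (z != 0).
Proof.
rewrite lt_neqAle normc_ge0 andbT eq_sym; congr (~~ _).
by apply/eqP/eqP => [/eq0_normc|->] //; rewrite normc0.
Qed.

Lemma norm_normc (R : realType) (z : Cplx R) : `|z| = (normc (z : R[i]))%:C%C.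
Proof. by []. Qed.

(** The epsilon-delta form, with real epsilon and delta, of complex
    differentiability; [has_cderivP] relates it to the topological notion. *)
Definition has_cderiv (R : realType) (f : R[i] -> R[i]) (z d : R[i]) : Prop :=
  forall e : R, 0 < e -> exists2 r : R, 0 < r &
    forall h, normc h < r -> normc (f (z + h) - f z - d * h) <= e * normc h.

Lemma normcB (R : realType) (x y : R[i]) : normc (x - y) = normc (y - x).
Proof. by rewrite -normc_opp opprB. Qed.

Lemma pos_complexP (R : realType) (e : R[i]) : 0 < e -> exists2 r : R, 0 < r & e = r%:C%C.
Proof.
case: e => a b; rewrite ltcE /= => /andP[/eqP -> a0]; by exists a.
Qed.

Lemma diff_quotient_error (F : fieldType) (h d u v : F) : h != 0 ->
  d - h^-1 * (u - v) = - (h^-1 * (u - v - d * h)).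
Proof. by move=> h0; field. Qed.

Lemma has_cderivP (R : realType) (f : Cplx R -> Cplx R) (z d : Cplx R) :
  has_cderiv f z d <-> is_derive z (1 : Cplx R) f d.
Proof.
split=> [H|[df vd]].
- have cv : (fun h : Cplx R => h^-1 *: ((f \o shift z) (h *: (1 : Cplx R)) - f z)) @ 0^' --> d.
    apply/cvgrPdist_le => e /pos_complexP[r r0 ->].
    have [s s0 Hs] := H _ r0.
    apply/nbhs_ballP; exists (s%:C)%C => /=; first by rewrite ltcR.
    move=> h; rewrite -ball_normE /= sub0r normrN norm_normc ltcR => hs hn0.
    rewrite norm_normc lecR.
    have h0 : 0 < normc h.
      by rewrite normc_gt0.
    rewrite /GRing.scale /= mulr1.
    rewrite (@diff_quotient_error R[i] h d) // [h + z]addrC.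
    rewrite normc_opp normcM normcV mulrC ler_pdivrMr //.
    by have := Hs _ hs.
  by split; [apply/cvg_ex; exists d | exact: cvg_lim cv].
- move=> e e0.
  have cv : (fun h : Cplx R => h^-1 *: ((f \o shift z) (h *: (1 : Cplx R)) - f z)) @ 0^' --> d.
    by rewrite -vd; exact: df.
  move/cvgrPdist_le : cv => /(_ (e%:C)%C); rewrite ltcR => /(_ e0).
  move/nbhs_ballP => [s0 /= /pos_complexP[s sp ->] Hs].
  exists s => // h hs.
  have [->|hn0] := eqVneq h 0.
    by rewrite addr0 subrr mulr0 subr0 normc0 mulr0.
  have := Hs h; rewrite -ball_normE /= sub0r normrN norm_normc ltcR => /(_ hs hn0).
  rewrite norm_normc lecR /GRing.scale /= mulr1.
  have h0 : 0 < normc h.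
    by rewrite normc_gt0.
  rewrite (@diff_quotient_error R[i] h d) // [h + z]addrC.
  by rewrite normc_opp normcM normcV mulrC ler_pdivrMr.
Qed.

(** * Integrals along segments *)

Lemma real_antiderivative (R : realType) (g : R -> R) :
  continuous g -> exists G : R -> R, forall x, is_derive x (1 : R) G (g x).
Proof.
move=> cg.
pose mu := @lebesgue_measure R.
have ig (a b : R) : mu.-integrable `[a, b] (EFin \o g).
  apply: continuous_compact_integrable; first exact: segment_compact.
  exact: continuous_subspaceT.
pose F (a x : R) : R := (\int[mu]_(t in `[a, x]) g t)%R.
have dF (a x : R) : a < x -> is_derive x (1 : R) (F a) (g x).
  move=> ax; have [||d v] := @continuous_FTC1_closed R g a x (x + 1) _ (ig _ _) ax.
  - by rewrite ltrDl.
  - exact: cg.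
  - by split; [exact: d | rewrite -v; exact/esym/derive1E].
have Fadd (a b x : R) : a <= b -> b <= x -> F a x - F a b = F b x.
  move=> ab bx; rewrite /F Rintegral_itvB //.
  - by rewrite Rintegral_itv_obnd_cbnd //; apply: integrableS (ig b x) => //;
    exact: subset_itv_oc_cc.
exists (fun x => F (- (`|x| + 1)) x - F (- (`|x| + 1)) 0) => x.
(* The base point moves with the argument so that one formula serves the whole
   line; near [x] additivity lets it be frozen. *)
pose M : R := - (`|x| + 2).
have dM : is_derive x (1 : R) (F M - cst (F M 0)) (g x).
  have Mx : M < x.
    by rewrite /M; have := ler_norm (- x); rewrite normrN; lra.
  have := is_deriveB (dF _ _ Mx) (is_derive_cst (F M 0) x (1 : R)).
  by rewrite subr0.
apply: near_eq_is_derive dM.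
apply/nbhs_ballP; exists 1 => //= y; rewrite /ball /= => xy.
have My : M <= - (`|y| + 1).
  have : `|y| <= `|x| + `|x - y|.
    by rewrite -[X in `|X| <= _](subKr x); exact: ler_normB.
  by rewrite /M; lra.
have ny : - (`|y| + 1) <= y by have := ler_norm (- y); rewrite normrN; lra.
have n0 : - (`|y| + 1) <= 0 by have := normr_ge0 y; lra.
rewrite !fctE -(Fadd _ _ _ My ny) -(Fadd _ _ _ My n0).
lra.
Qed.

Lemma normc_ge_absRe (R : realType) (z : R[i]) : `|complex.Re z| <= normc z.
Proof. by case: z => a b /=; rewrite -sqrtr_sqr ler_wsqrtr // lerDl sqr_ge0. Qed.

Lemma normc_ge_absIm (R : realType) (z : R[i]) : `|complex.Im z| <= normc z.
Proof. by case: z => a b /=; rewrite -sqrtr_sqr ler_wsqrtr // lerDr sqr_ge0. Qed.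

Lemma normc_real (R : realType) (x : R) : normc (x%:C)%C = `|x|.
Proof. by rewrite /= expr0n /= addr0 sqrtr_sqr. Qed.

Lemma normc_i (R : realType) : normc ('i%C : R[i]) = 1.
Proof. by rewrite /= expr0n /= add0r expr1n sqrtr1. Qed.

Lemma normc_le_absD (R : realType) (z : R[i]) :
  normc z <= `|complex.Re z| + `|complex.Im z|.
Proof.
rewrite [X in normc X]complexE; apply: (le_trans (normcD _ _)).
by rewrite normcM normc_i mul1r !normc_real.
Qed.

Lemma normc_sum (R : realType) (I : Type) (r : seq I) (F : I -> R[i]) :
  normc (\sum_(i <- r) F i) <= \sum_(i <- r) normc (F i).
Proof.
elim/big_ind2: _ => [|u1 u2 v1 v2 h1 h2|//]; first by rewrite normc0.
by apply: (le_trans (normcD _ _)); exact: lerD.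
Qed.

Lemma normcX (R : realType) (z : R[i]) n : normc (z ^+ n) = normc z ^+ n.
Proof. by elim: n => [|n IH]; rewrite ?expr0 ?normc1 // !exprS normcM IH. Qed.

Section ComplexIntegral.
Variable R : realType.
Implicit Types (g h G H : R -> R[i]) (k : R[i]).

Definition curve_cont g := forall (t e : R), 0 < e -> exists2 d : R, 0 < d &
  forall s, `|s - t| < d -> normc (g s - g t) < e.

(** Stated on real and imaginary parts, so that the real mean value theorem and
    fundamental theorem of calculus apply to each of them. *)
Definition antideriv G g := forall t : R,
  is_derive t (1 : R) (fun x => complex.Re (G x)) (complex.Re (g t)) /\
  is_derive t (1 : R) (fun x => complex.Im (G x)) (complex.Im (g t)).

Lemma ReB (u v : R[i]) : complex.Re (u - v) = complex.Re u - complex.Re v.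
Proof. by case: u; case: v. Qed.
Lemma ImB (u v : R[i]) : complex.Im (u - v) = complex.Im u - complex.Im v.
Proof. by case: u; case: v. Qed.
Lemma ReD (u v : R[i]) : complex.Re (u + v) = complex.Re u + complex.Re v.
Proof. by case: u; case: v. Qed.
Lemma ImD (u v : R[i]) : complex.Im (u + v) = complex.Im u + complex.Im v.
Proof. by case: u; case: v. Qed.
Lemma ReM (u v : R[i]) : complex.Re (u * v) =
  complex.Re u * complex.Re v - complex.Im u * complex.Im v.
Proof. by case: u; case: v. Qed.
Lemma ImM (u v : R[i]) : complex.Im (u * v) =
  complex.Re u * complex.Im v + complex.Im u * complex.Re v.
Proof. by case: u; case: v. Qed.

Lemma curve_cont_part (p : R[i] -> R) g :
  (forall u v, p (u - v) = p u - p v) -> (forall u, `|p u| <= normc u) ->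
  curve_cont g -> continuous (fun t => p (g t)).
Proof.
move=> pB pn cg t; apply/cvgrPdist_lt => e e0.
have [d d0 dP] := cg t _ e0.
apply/nbhs_ballP; exists d => //= s; rewrite /ball /= => ts.
rewrite distrC -pB (le_lt_trans (pn _)) // dP // distrC.
exact: ts.
Qed.

Lemma curve_cont_antideriv g : curve_cont g -> exists G, antideriv G g.
Proof.
move=> cg.
have [A dA] := real_antiderivative (curve_cont_part ReB (@normc_ge_absRe R) cg).
have [B dB] := real_antiderivative (curve_cont_part ImB (@normc_ge_absIm R) cg).
exists (fun t => Complex (A t) (B t)) => t; split; [exact: dA | exact: dB].
Qed.

Lemma antideriv_unique g G H a b : antideriv G g -> antideriv H g ->
  G b - G a = H b - H a.
Proof.
move=> dG dH.
have cst0 (p : R[i] -> R) : (forall u v, p (u - v) = p u - p v) ->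
    (forall t, is_derive t (1 : R) (fun x => p (G x)) (p (g t))) ->
    (forall t, is_derive t (1 : R) (fun x => p (H x)) (p (g t))) ->
    p (G b - G a) = p (H b - H a).
  move=> pB d1 d2.
  have d t : is_derive t (1 : R) ((fun x => p (G x)) - (fun x => p (H x))) 0.
    by have := is_deriveB (d1 t) (d2 t); rewrite subrr.
  have := is_derive_0_is_cst a b d; rewrite !fctE !pB.
  lra.
apply/eqP; rewrite eq_complex; apply/andP; split; apply/eqP.
- by apply: cst0 => [u v|t|t]; [exact: ReB | have [] := dG t | have [] := dH t].
- by apply: cst0 => [u v|t|t]; [exact: ImB | have [] := dG t | have [] := dH t].
Qed.

(** Taking the integral of a curve to be the increment of a chosen antiderivative,
    defined on the whole line, makes additivity over intervals hold by
    computation. *)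
Definition antider g : R -> R[i] :=
  if pselect (exists G, antideriv G g) is left e then projT1 (cid e) else fun=> 0.

Definition curve_int g (a b : R) : R[i] := antider g b - antider g a.

Lemma antiderP g : curve_cont g -> antideriv (antider g) g.
Proof.
move=> /curve_cont_antideriv eG; rewrite /antider; case: pselect => // e.
by case: cid.
Qed.

Lemma curve_intE g G a b : curve_cont g -> antideriv G g -> curve_int g a b = G b - G a.
Proof. by move=> /antiderP cg dG; exact: antideriv_unique dG. Qed.

Lemma antiderivZD k g h G H : antideriv G g -> antideriv H h ->
  antideriv (fun t => k * G t + H t) (fun t => k * g t + h t).
Proof.
move=> dG dH t; have [r1 i1] := dG t; have [r2 i2] := dH t.
split.
- have := is_deriveD (is_deriveB (is_deriveZ (complex.Re k) r1)
    (is_deriveZ (complex.Im k) i1)) r2.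
  congr (is_derive _ _ _ _); last by rewrite ReD ReM.
  by apply/funext => x; rewrite !fctE ReD ReM.
- have := is_deriveD (is_deriveD (is_deriveZ (complex.Re k) i1)
    (is_deriveZ (complex.Im k) r1)) i2.
  congr (is_derive _ _ _ _); last by rewrite ImD ImM.
  by apply/funext => x; rewrite !fctE ImD ImM.
Qed.

Lemma eq_curve_int g h a b : (forall t, g t = h t) -> curve_int g a b = curve_int h a b.
Proof. by move=> /funext ->. Qed.

Lemma curve_contZD k g h : curve_cont g -> curve_cont h -> curve_cont (fun t => k * g t + h t).
Proof.
move=> cg ch t e e0.
have k1 : 0 < normc k + 1 by have := normc_ge0 k; lra.
have e1 : 0 < e / 2 / (normc k + 1) by rewrite divr_gt0 // divr_gt0.
have e2 : 0 < e / 2 by lra.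
have [d1 d10 H1] := cg t _ e1; have [d2 d20 H2] := ch t _ e2.
exists (Num.min d1 d2); first by rewrite lt_min d10.
move=> s; rewrite lt_min => /andP[/H1 s1 /H2 s2].
have -> : k * g s + h s - (k * g t + h t) = k * (g s - g t) + (h s - h t) by ring.
apply: (le_lt_trans (normcD _ _)); rewrite normcM.
have : normc k * normc (g s - g t) <= e / 2.
  apply: (@le_trans _ _ ((normc k + 1) * (e / 2 / (normc k + 1)))).
    by rewrite ler_pM ?normc_ge0 //; [lra | exact: ltW].
  by rewrite mulrC divfK // gt_eqF.
lra.
Qed.

Lemma curve_intZD k g h a b : curve_cont g -> curve_cont h ->
  curve_int (fun t => k * g t + h t) a b = k * curve_int g a b + curve_int h a b.
Proof.
move=> cg ch; rewrite (curve_intE _ _ (curve_contZD k cg ch)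
  (antiderivZD k (antiderP cg) (antiderP ch))).
by rewrite /curve_int; ring.
Qed.

Lemma curve_cont_cst k : curve_cont (fun=> k).
Proof. by move=> t e e0; exists 1 => // s _; rewrite subrr normc0. Qed.

Lemma curve_int_mvt (p : R[i] -> R) g a b :
  (forall u v, p (u - v) = p u - p v) -> curve_cont g ->
  (forall t, is_derive t (1 : R) (fun x => p (antider g x)) (p (g t))) ->
  a <= b -> exists2 c, a <= c <= b & p (curve_int g a b) = p (g c) * (b - a).
Proof.
move=> pB cg d ab.
have := @MVT_segment R (fun x => p (antider g x)) (fun x => p (g x)) a b ab (fun x _ => d x).
case=> [|c]; first by apply: derivable_within_continuous => x _; exact: ex_derive.
by rewrite in_itv /= => cab E; exists c => //; rewrite /curve_int pB.
Qed.

Lemma curve_int_Re_mvt g a b : curve_cont g -> a <= b ->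
  exists2 c, a <= c <= b & complex.Re (curve_int g a b) = complex.Re (g c) * (b - a).
Proof.
by move=> cg; apply: curve_int_mvt => // [u v|t]; [exact: ReB | have [] := antiderP cg t].
Qed.

Lemma curve_int_Im_mvt g a b : curve_cont g -> a <= b ->
  exists2 c, a <= c <= b & complex.Im (curve_int g a b) = complex.Im (g c) * (b - a).
Proof.
by move=> cg; apply: curve_int_mvt => // [u v|t]; [exact: ImB | have [] := antiderP cg t].
Qed.

(** The factor 2 is the price of applying the mean value theorem to the real and
    imaginary parts separately. *)
Lemma curve_int_bound g a b M : curve_cont g -> a <= b ->
  (forall t, a <= t <= b -> normc (g t) <= M) ->
  normc (curve_int g a b) <= 2 * M * (b - a).
Proof.
move=> cg ab gM; apply: (le_trans (normc_le_absD _)).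
have ba : 0 <= b - a by lra.
have [c1 cab1 ->] := curve_int_Re_mvt cg ab; have [c2 cab2 ->] := curve_int_Im_mvt cg ab.
rewrite !normrM (ger0_norm ba) -mulrDl ler_wpM2r //.
have := le_trans (normc_ge_absRe (g c1)) (gM _ cab1).
have := le_trans (normc_ge_absIm (g c2)) (gM _ cab2).
lra.
Qed.

End ComplexIntegral.

(** * Integrals over the boundary of a rectangle *)

Section RectangleIntegral.
Variable R : realType.
Implicit Types (f g : R[i] -> R[i]) (k z w : R[i]).

Definition cont_at f (z : R[i]) := forall e : R, 0 < e -> exists2 r : R, 0 < r &
  forall h, normc h < r -> normc (f (z + h) - f z) < e.

Definition cont f := forall z, cont_at f z.

Definition hline f (y : R) : R -> R[i] := fun t => f (Complex t y).
Definition vline f (x : R) : R -> R[i] := fun t => f (Complex x t).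

Lemma curve_cont_hline f y : (forall t, cont_at f (Complex t y)) -> curve_cont (hline f y).
Proof.
move=> cf t e e0; have [d d0 H] := cf t e e0.
exists d => // s st; rewrite /hline.
have -> : Complex s y = Complex t y + (s - t)%:C%C :> R[i].
  by rewrite /real_complex_def; apply/eqP; rewrite eq_complex /= addr0 subrKC !eqxx.
by apply: H; rewrite normc_real.
Qed.

Lemma curve_cont_vline f x : (forall t, cont_at f (Complex x t)) -> curve_cont (vline f x).
Proof.
move=> cf t e e0; have [d d0 H] := cf t e e0.
exists d => // s st; rewrite /vline.
have -> : Complex x s = Complex x t + 'i%C * (s - t)%:C%C :> R[i].
  by apply/eqP; rewrite eq_complex /= !mulr0 !mul0r !mul1r subr0 !addr0 add0r subrKC !eqxx.
by apply: H; rewrite normcM normc_i mul1r normc_real.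
Qed.

Lemma contZD k f g : cont f -> cont g -> cont (fun z => k * f z + g z).
Proof.
move=> cf cg z e e0.
have k1 : 0 < normc k + 1 by have := normc_ge0 k; lra.
have e1 : 0 < e / 2 / (normc k + 1) by rewrite divr_gt0 // divr_gt0.
have e2 : 0 < e / 2 by lra.
have [d1 d10 H1] := cf z _ e1; have [d2 d20 H2] := cg z _ e2.
exists (Num.min d1 d2); first by rewrite lt_min d10.
move=> h; rewrite lt_min => /andP[/H1 s1 /H2 s2].
have -> : k * f (z + h) + g (z + h) - (k * f z + g z) =
  k * (f (z + h) - f z) + (g (z + h) - g z) by ring.
apply: (le_lt_trans (normcD _ _)); rewrite normcM.
have : normc k * normc (f (z + h) - f z) <= e / 2.
  apply: (@le_trans _ _ ((normc k + 1) * (e / 2 / (normc k + 1)))).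
    by rewrite ler_pM ?normc_ge0 //; [lra | exact: ltW].
  by rewrite mulrC divfK // gt_eqF.
lra.
Qed.

Lemma cont_cst k : cont (fun=> k).
Proof. by move=> t e e0; exists 1 => // s _; rewrite subrr normc0. Qed.

Lemma cont_id : cont id.
Proof. by move=> t e e0; exists e => // s; rewrite addrAC subrr add0r. Qed.

Lemma has_cderiv_cont_at f z d : has_cderiv f z d -> cont_at f z.
Proof.
move=> df e e0; have [r r0 H] := df 1 ltr01.
have d1 : 0 < normc d + 2 by have := normc_ge0 d; lra.
exists (Num.min r (e / (normc d + 2))); first by rewrite lt_min r0 divr_gt0.
move=> h; rewrite lt_min => /andP[/H hr he].
have -> : f (z + h) - f z = (f (z + h) - f z - d * h) + d * h by ring.
apply: (le_lt_trans (normcD _ _)); rewrite normcM.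
move: he; rewrite ltr_pdivlMr // => he.
have := normc_ge0 h; nra.
Qed.

(** The contour integral over the boundary of [a, b] x [c, d], counterclockwise. *)
Definition rectint f (a b c d : R) : R[i] :=
  curve_int (hline f c) a b + 'i%C * curve_int (vline f b) c d
  - curve_int (hline f d) a b - 'i%C * curve_int (vline f a) c d.

Definition rectcont f (a b c d : R) : Prop :=
  [/\ curve_cont (hline f c), curve_cont (vline f b),
      curve_cont (hline f d) & curve_cont (vline f a)].

Lemma cont_rectcont f a b c d : cont f -> rectcont f a b c d.
Proof.
by move=> cf; split; [apply: curve_cont_hline|apply: curve_cont_vline|apply: curve_cont_hline|
  apply: curve_cont_vline] => t; exact: cf.
Qed.

Lemma rectintZD k f g a b c d : rectcont f a b c d -> rectcont g a b c d ->
  rectint (fun z => k * f z + g z) a b c d = k * rectint f a b c d + rectint g a b c d.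
Proof.
move=> [f1 f2 f3 f4] [g1 g2 g3 g4]; rewrite /rectint.
rewrite (curve_intZD k a b f1 g1) (curve_intZD k c d f2 g2).
rewrite (curve_intZD k a b f3 g3) (curve_intZD k c d f4 g4).
ring.
Qed.

Lemma rectcont_cst k a b c d : rectcont (fun=> k) a b c d.
Proof. by split; exact: curve_cont_cst. Qed.

Lemma rectint_splitx f a m b c d :
  rectint f a b c d = rectint f a m c d + rectint f m b c d.
Proof. by rewrite /rectint /curve_int; ring. Qed.

Lemma rectint_splity f a b c m d :
  rectint f a b c d = rectint f a b c m + rectint f a b m d.
Proof. by rewrite /rectint /curve_int; ring. Qed.

Lemma rectint_bound f a b c d M : rectcont f a b c d -> a <= b -> c <= d ->
  (forall x y, a <= x <= b -> c <= y <= d -> (x == a) || (x == b) || (y == c) || (y == d) ->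
     normc (f (Complex x y)) <= M) ->
  normc (rectint f a b c d) <= 4 * M * ((b - a) + (d - c)).
Proof.
move=> [f1 f2 f3 f4] ab cd fM; rewrite /rectint.
have cc : c <= c <= d by rewrite lexx.
have dd : c <= d <= d by rewrite lexx andbT.
have aa : a <= a <= b by rewrite lexx.
have bb : a <= b <= b by rewrite lexx andbT.
have B1 : normc (curve_int (hline f c) a b) <= 2 * M * (b - a).
  by apply: curve_int_bound => // t tab; apply: fM => //; rewrite eqxx !orbT.
have B3 : normc (curve_int (hline f d) a b) <= 2 * M * (b - a).
  by apply: curve_int_bound => // t tab; apply: fM => //; rewrite eqxx !orbT.
have B2 : normc (curve_int (vline f b) c d) <= 2 * M * (d - c).
  by apply: curve_int_bound => // t tab; apply: fM => //; rewrite eqxx !orbT.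
have B4 : normc (curve_int (vline f a) c d) <= 2 * M * (d - c).
  by apply: curve_int_bound => // t tab; apply: fM => //; rewrite eqxx.
apply: (le_trans (normcD _ _)); rewrite normc_opp normcM normc_i mul1r.
have := normcD (curve_int (hline f c) a b + 'i%C * curve_int (vline f b) c d)
  (- curve_int (hline f d) a b).
rewrite normc_opp.
have := normcD (curve_int (hline f c) a b) ('i%C * curve_int (vline f b) c d).
rewrite normcM normc_i mul1r.
lra.
Qed.

Lemma rectint_cst k a b c d : rectint (fun=> k) a b c d = 0.
Proof.
by rewrite /rectint /hline /vline; ring.
Qed.

Lemma is_derive_lin (u v t : R) : is_derive t (1 : R) (fun x => u * x + v) u.
Proof.
have -> : (fun x => u * x + v) = (fun x : R => u * x) + cst v by [].
by apply: is_derive_eq; rewrite addr0 /GRing.scale /= mulr1.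
Qed.

Lemma is_derive_halfsq (t : R) : is_derive t (1 : R) (fun x => x ^+ 2 / 2) t.
Proof.
have -> : (fun x : R => x ^+ 2 / 2) = (2^-1 : R) *: (id : R -> R) ^+ 2.
  by apply/funext => x; rewrite !fctE /GRing.scale /= mulrC.
by apply: is_derive_eq; rewrite /GRing.scale /= mulr1 expr1; lra.
Qed.

Lemma rectint_id a b c d : rectint id a b c d = 0.
Proof.
have H y u v : curve_int (hline id y) u v = Complex ((v ^+ 2 - u ^+ 2) / 2) (y * (v - u)).
  rewrite (@curve_intE _ _ (fun t => Complex (t ^+ 2 / 2) (y * t + 0))).
  - by apply/eqP; rewrite eq_complex /=; apply/andP; split; apply/eqP; field.
  - by apply: curve_cont_hline => t; exact: cont_id.
  - by move=> t; split; [exact: is_derive_halfsq | exact: is_derive_lin].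
have V x u v : curve_int (vline id x) u v = Complex (x * (v - u)) ((v ^+ 2 - u ^+ 2) / 2).
  rewrite (@curve_intE _ _ (fun t => Complex (x * t + 0) (t ^+ 2 / 2))).
  - by apply/eqP; rewrite eq_complex /=; apply/andP; split; apply/eqP; field.
  - by apply: curve_cont_vline => t; exact: cont_id.
  - by move=> t; split; [exact: is_derive_lin | exact: is_derive_halfsq].
rewrite /rectint !H !V; apply/eqP; rewrite eq_complex /=.
by apply/andP; split; apply/eqP; field.
Qed.

End RectangleIntegral.

Lemma nested_intervals (R : realType) (u l : nat -> R) :
  (forall n, u n <= u n.+1) -> (forall n, u n.+1 + l n.+1 <= u n + l n) ->
  (forall n, 0 <= l n) -> exists p, forall n, u n <= p <= u n + l n.
Proof.
move=> u1 u2 l0.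
have mono n m : (n <= m)%N -> u n <= u m.
  by move=> nm; apply: (homo_leq (@lexx _ _) (@le_trans _ _) u1).
have anti n m : (n <= m)%N -> u m + l m <= u n + l n.
  move=> nm; apply: (@homo_leq _ (fun n => u n + l n) (fun x y => y <= x)) => //.
  by move=> y x z xy yz; exact: le_trans yz xy.
have bnd n m : u n <= u m + l m.
  have [nm|/ltnW mn] := leqP n m.
    by apply: (le_trans (mono _ _ nm)); rewrite lerDl.
  by apply: le_trans (anti _ _ mn); rewrite lerDl.
exists (sup (range u)) => n; apply/andP; split.
- apply: ub_le_sup; last by exists n.
  by exists (u 0%N + l 0%N) => _ [m _ <-].
- apply: ge_sup; first by exists (u 0%N); exists 0%N.
  by move=> _ [m _ <-].
Qed.

(** * The theorem of Goursat *)

Section Goursat.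
Variable R : realType.
Implicit Types (f g : R[i] -> R[i]) (k z w : R[i]).

Lemma rectint_quarter f (x y s t : R) :
  rectint f x (x + s + s) y (y + t + t) =
  (rectint f x (x + s) y (y + t) + rectint f (x + s) (x + s + s) y (y + t)) +
  (rectint f x (x + s) (y + t) (y + t + t) +
   rectint f (x + s) (x + s + s) (y + t) (y + t + t)).
Proof.
rewrite (rectint_splity f x (x + s + s) y (y + t)).
rewrite (rectint_splitx f x (x + s) (x + s + s) y).
by rewrite (rectint_splitx f x (x + s) (x + s + s) (y + t)).
Qed.

Lemma exp2_half (s : R) n : s / 2 ^+ n = s / 2 ^+ n.+1 + s / 2 ^+ n.+1.
Proof.
rewrite exprS; have : (2 : R) ^+ n != 0 by rewrite expf_neq0 // pnatr_eq0.
by move: (2 ^+ n) => u u0; field.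
Qed.

(** The integral is the sum of those over the four quarters, so one of them keeps
    at least a quarter of its modulus. *)
Lemma goursat_step f (s t eta : R) n (p : R * R) :
  eta / 4 ^+ n <= normc (rectint f p.1 (p.1 + s / 2 ^+ n) p.2 (p.2 + t / 2 ^+ n)) ->
  exists ij : bool * bool,
  let q := (p.1 + ij.1%:R * (s / 2 ^+ n.+1), p.2 + ij.2%:R * (t / 2 ^+ n.+1)) in
  eta / 4 ^+ n.+1 <=
    normc (rectint f q.1 (q.1 + s / 2 ^+ n.+1) q.2 (q.2 + t / 2 ^+ n.+1)).
Proof.
case: p => x y /=; rewrite (exp2_half s) (exp2_half t) !addrA rectint_quarter.
set s' := s / _; set t' := t / _ => H.
have E4 : eta / 4 ^+ n = 4 * (eta / 4 ^+ n.+1).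
  rewrite exprS; have : (4 : R) ^+ n != 0 by rewrite expf_neq0 // pnatr_eq0.
  by move: (4 ^+ n) => u u0; field.
rewrite E4 in H; set e := eta / _ in H *.
have [|h1] := leP e (normc (rectint f x (x + s') y (y + t'))).
  by exists (false, false); rewrite /= !mul0r !addr0.
have [|h2] := leP e (normc (rectint f (x + s') (x + s' + s') y (y + t'))).
  by exists (true, false); rewrite /= !mul0r !mul1r !addr0.
have [|h3] := leP e (normc (rectint f x (x + s') (y + t') (y + t' + t'))).
  by exists (false, true); rewrite /= !mul0r !mul1r !addr0.
exists (true, true); rewrite /= !mul1r.
move: H h1 h2 h3.
set A := rectint _ _ _ _ _; set B := rectint _ _ _ _ _.
set C := rectint _ _ _ _ _; set D := rectint _ _ _ _ _ => H h1 h2 h3.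
have := normcD (A + B) (C + D); have := normcD A B; have := normcD C D.
lra.
Qed.

(** Bisect repeatedly, always keeping a quarter of the integral.  At the point
    common to all the rectangles f is affine up to o(|h|); affine functions
    integrate to 0, and what is left is o(perimeter^2), which decreases faster
    than 4^-n. *)
Lemma goursat f (a b c d : R) : a <= b -> c <= d -> cont f ->
  (forall x y, a <= x <= b -> c <= y <= d -> exists k, has_cderiv f (Complex x y) k) ->
  rectint f a b c d = 0.
Proof.
move=> ab cd cf df; apply/eqP; apply: contraT => nz.
have eta0 : 0 < normc (rectint f a b c d).
  by rewrite normc_gt0.
set eta := normc _ in eta0.
pose s := b - a; pose t := d - c.
have s0 : 0 <= s by rewrite /s; lra.
have t0 : 0 <= t by rewrite /t; lra.
pose big n (p : R * R) :=
  eta / 4 ^+ n <= normc (rectint f p.1 (p.1 + s / 2 ^+ n) p.2 (p.2 + t / 2 ^+ n)).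
have stepP (np : nat * (R * R)) : exists ij : bool * bool, big np.1 np.2 ->
    big np.1.+1 (np.2.1 + ij.1%:R * (s / 2 ^+ np.1.+1),
                 np.2.2 + ij.2%:R * (t / 2 ^+ np.1.+1)).
  case: np => n p /=; have [bp|nbp] := pselect (big n p); last by exists (true, true).
  by have [ij H] := goursat_step bp; exists ij.
have [ch chP] := choice stepP.
pose seq := fix seq n : R * R := if n is m.+1 then
  let p := seq m in let ij := ch (m, p) in
  (p.1 + ij.1%:R * (s / 2 ^+ m.+1), p.2 + ij.2%:R * (t / 2 ^+ m.+1)) else (a, c).
have seqS n : seq n.+1 = ((seq n).1 + (ch (n, seq n)).1%:R * (s / 2 ^+ n.+1),
   (seq n).2 + (ch (n, seq n)).2%:R * (t / 2 ^+ n.+1)) by [].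
have bigseq n : big n (seq n).
  elim: n => [|n IH].
    by rewrite /big /= !expr0 !divr1 /s /t !subrKC.
  exact: (chP (n, seq n)) IH.
have pw (u : R) n : 0 <= u -> 0 <= u / 2 ^+ n.
  by move=> u0; rewrite divr_ge0 // exprn_ge0.
have inc (u : R) (j : bool) n : 0 <= u ->
  0 <= j%:R * (u / 2 ^+ n.+1) /\ j%:R * (u / 2 ^+ n.+1) + u / 2 ^+ n.+1 <= u / 2 ^+ n.
  move=> u0; rewrite (exp2_half u n); have := pw u n.+1 u0.
  by case: j; rewrite ?mul1r ?mul0r; lra.
have [px Px] : exists p, forall n, (seq n).1 <= p <= (seq n).1 + s / 2 ^+ n.
  apply: nested_intervals => n; rewrite ?seqS /=.
  - by have [] := inc s (ch (n, seq n)).1 n s0; lra.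
  - by have [] := inc s (ch (n, seq n)).1 n s0; lra.
  - exact: pw.
have [py Py] : exists p, forall n, (seq n).2 <= p <= (seq n).2 + t / 2 ^+ n.
  apply: nested_intervals => n; rewrite ?seqS /=.
  - by have [] := inc t (ch (n, seq n)).2 n t0; lra.
  - by have [] := inc t (ch (n, seq n)).2 n t0; lra.
  - exact: pw.
have [||k dk] := df px py.
- by have := Px 0%N; rewrite /= expr0 divr1 /s subrKC.
- by have := Py 0%N; rewrite /= expr0 divr1 /t subrKC.
(* The final estimate reads eta <= 4 (eta / K) (s + t)^2, impossible for this K. *)
pose K := 8 * (s + t) ^+ 2 + 1.
have K0 : 0 < K by have := sqr_ge0 (s + t); rewrite /K; lra.
have e0 : 0 < eta / K by rewrite divr_gt0.
have [r r0 Hr] := dk _ e0.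
have [n nP] : exists n, (s + t) / 2 ^+ n < r.
  exists (Num.bound ((s + t) / r)).
  have st0 : 0 <= (s + t) / r by apply: divr_ge0; [exact: addr_ge0 | exact: ltW].
  rewrite ltr_pdivrMr ?exprn_gt0 // mulrC -ltr_pdivrMr //.
  apply: lt_trans (archi_boundP st0) _.
  by rewrite -natrX ltr_nat ltn_expl.
have := bigseq n; rewrite /big; have := Px n; have := Py n.
move: (seq n) => [x y] /= Pyn Pxn.
set x' := x + _; set y' := y + _.
have xx' : x <= x' by rewrite lerDl pw.
have yy' : y <= y' by rewrite lerDl pw.
pose p : R[i] := Complex px py.
pose aff z := k * z + (f p - k * p).
have caff : cont aff by apply: (contZD k (@cont_id R)); exact: cont_cst.
pose err z := (-1) * aff z + f z.
have cerr : cont err by exact: contZD.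
have -> : rectint f x x' y y' = rectint err x x' y y'.
  rewrite (rectintZD (-1) (cont_rectcont x x' y y' caff) (cont_rectcont x x' y y' cf)).
  rewrite (rectintZD k (cont_rectcont x x' y y' (@cont_id R)) (rectcont_cst _ _ _ _ _)).
  by rewrite rectint_id rectint_cst; ring.
pose D := (s + t) / 2 ^+ n.
have DE : D = s / 2 ^+ n + t / 2 ^+ n by rewrite /D mulrDl.
have D0 : 0 <= D by rewrite DE addr_ge0 // pw.
have errB : normc (rectint err x x' y y') <= 4 * (eta / K * D) * ((x' - x) + (y' - y)).
  apply: rectint_bound => //; first exact: cont_rectcont.
  move=> u v ux vy _; pose h : R[i] := Complex u v - p.
  have -> : Complex u v = p + h by rewrite /h subrKC.
  have hD : normc h <= D.
    apply: (le_trans (normc_le_absD _)); rewrite /h ReB ImB /= DE.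
    apply: lerD; rewrite ler_norml; apply/andP; split; move: ux vy Pxn Pyn;
      rewrite /x' /y'; lra.
  have -> : err (p + h) = f (p + h) - f p - k * h by rewrite /err /aff; ring.
  apply: (le_trans (Hr _ (le_lt_trans hD nP))).
  by rewrite ler_wpM2l // ltW.
move=> etan; have := le_trans etan errB.
have -> : x' - x + (y' - y) = D by rewrite /x' /y' DE; ring.
have -> : 4 * (eta / K * D) * D = (4 * (s + t) ^+ 2 / K * eta) / 4 ^+ n.
  rewrite /D.
  have E4 : (4 : R) ^+ n = (2 ^+ n) ^+ 2 by rewrite -exprM mulnC exprM; congr (_ ^+ _); ring.
  have : (2 : R) ^+ n != 0 by rewrite expf_neq0 // pnatr_eq0.
  by rewrite E4; move: (2 ^+ n) => u u0; field; rewrite u0 gt_eqF.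
rewrite ler_pM2r ?invr_gt0 ?exprn_gt0 // -[X in X <= _]mul1r ler_pM2r // ler_pdivlMr //.
by rewrite /K; have := sqr_ge0 (s + t); lra.
Qed.

(** A point where g is only continuous is harmless: cut the rectangle in a 3 x 3
    pattern with a tiny square around the point; the integral over the boundary of
    the square is at most its perimeter times a local bound. *)
Lemma goursat_exceptional g (a b c d wx wy : R) :
  a < wx < b -> c < wy < d -> cont g ->
  (forall z, z != Complex wx wy -> exists k, has_cderiv g z k) ->
  rectint g a b c d = 0.
Proof.
move=> /andP[aw wb] /andP[cw wd] cg dg; apply/eqP; apply: contraT => nz.
have eta0 : 0 < normc (rectint g a b c d).
  by rewrite normc_gt0.
set eta := normc _ in eta0.
pose w : R[i] := Complex wx wy.
have [r r0 Hr] := cg w 1 ltr01.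
pose M := normc (g w) + 1.
have M0 : 0 < M by have := normc_ge0 (g w); rewrite /M; lra.
pose e := Num.min (Num.min (Num.min (wx - a) (b - wx)) (Num.min (wy - c) (d - wy)))
             (Num.min (r / 3) (eta / (17 * M))).
have e0 : 0 < e by rewrite !lt_min !divr_gt0 //; lra.
have [e1 [e2 [e3 [e4 [e5 e6]]]]] : e <= wx - a /\ e <= b - wx /\ e <= wy - c /\
    e <= d - wy /\ e <= r / 3 /\ e <= eta / (17 * M).
  by have := lexx e; rewrite {2}/e !le_min => /and3P[/andP[/andP[-> ->] /andP[-> ->]] -> ->].
have G (a' b' c' d' : R) : a' <= b' -> c' <= d' ->
    (b' < wx \/ wx < a' \/ d' < wy \/ wy < c') -> rectint g a' b' c' d' = 0.
  move=> ab cd out; apply: goursat => // x y xab ycd; apply: dg.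
  by apply/eqP => -[xw yw]; lra.
have eta_le : eta <= 4 * M * ((wx + e - (wx - e)) + (wy + e - (wy - e))).
  have -> : eta = normc (rectint g (wx - e) (wx + e) (wy - e) (wy + e)).
    rewrite /eta (rectint_splitx g a (wx - e)) (rectint_splitx g (wx - e) (wx + e)).
    rewrite (rectint_splity g (wx - e) _ _ (wy - e)).
    rewrite (rectint_splity g (wx - e) _ (wy - e) (wy + e)).
    by rewrite (G a) ?(G (wx + e)) ?(G _ _ c) ?(G _ _ (wy + e)) ?addr0 ?add0r //; lra.
  apply: rectint_bound; [exact: cont_rectcont | lra | lra |].
  move=> x y xw yw _.
  have -> : Complex x y = w + (Complex x y - w) :> R[i] by rewrite subrKC.
  set h := _ - w.
  have hr : normc h < r.
    apply: (le_lt_trans (normc_le_absD _)); rewrite /h ReB ImB /=.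
    have : `|x - wx| <= e by rewrite ler_norml; lra.
    have : `|y - wy| <= e by rewrite ler_norml; lra.
    lra.
  have -> : g (w + h) = (g (w + h) - g w) + g w by rewrite subrK.
  by apply: (le_trans (normcD _ _)); have := Hr _ hr; rewrite /M; lra.
move: e6; rewrite ler_pdivlMr; last by lra.
move=> e6; nra.
Qed.

End Goursat.

(** * Pointwise holomorphy *)

Section Hol.
Variable R : realType.
Implicit Types (f g : R[i] -> R[i]) (z w d : R[i]).

Lemma is_derive_real_eps (f : R -> R) (z d : R) :
  (forall e : R, 0 < e -> exists2 r : R, 0 < r &
    forall h, `|h| < r -> `|f (z + h) - f z - d * h| <= e * `|h|) ->
  is_derive z (1 : R) f d.
Proof.
move=> H.
have cv : (fun h : R => h^-1 *: ((f \o shift z) (h *: (1 : R)) - f z)) @ 0^' --> d.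
  apply/cvgrPdist_le => e e0.
  have [s s0 Hs] := H _ e0.
  apply/nbhs_ballP; exists s => //= h; rewrite /ball /= sub0r normrN => hs hn0.
  have h0 : 0 < `|h| by rewrite normr_gt0.
  rewrite /GRing.scale /= mulr1 (diff_quotient_error d) // [h + z]addrC.
  by rewrite normrN normrM normfV mulrC ler_pdivrMr // Hs.
by split; [apply/cvg_ex; exists d | exact: cvg_lim cv].
Qed.

Definition hol_at f z := exists d, has_cderiv f z d.

Lemma hol_at_cont_at f z : hol_at f z -> cont_at f z.
Proof. by case=> d; exact: has_cderiv_cont_at. Qed.

Lemma hol_atP f z : hol_at f z <-> derivable (f : Cplx R -> Cplx R) z (1 : Cplx R).
Proof.
split=> [[d /has_cderivP[]]//|/derivableP H].
by eexists; apply/has_cderivP; exact: H.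
Qed.

Lemma hol_at_cst k z : hol_at (fun=> k) z.
Proof. by apply/hol_atP; exact: derivable_cst. Qed.

Lemma hol_at_id z : hol_at id z.
Proof. by apply/hol_atP; exact: derivable_id. Qed.

Lemma hol_atD f g z : hol_at f z -> hol_at g z -> hol_at (fun z => f z + g z) z.
Proof. by move=> /hol_atP hf /hol_atP hg; apply/hol_atP; exact: derivableD hf hg. Qed.

Lemma hol_atB f g z : hol_at f z -> hol_at g z -> hol_at (fun z => f z - g z) z.
Proof. by move=> /hol_atP hf /hol_atP hg; apply/hol_atP; exact: derivableB hf hg. Qed.

Lemma hol_atM f g z : hol_at f z -> hol_at g z -> hol_at (fun z => f z * g z) z.
Proof. by move=> /hol_atP hf /hol_atP hg; apply/hol_atP; exact: derivableM hf hg. Qed.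

Lemma hol_atX f n z : hol_at f z -> hol_at (fun z => f z ^+ n) z.
Proof.
move=> hf; elim: n => [|n IH].
  have -> : (fun z => f z ^+ 0) = (fun=> 1) by apply/funext => x; rewrite expr0.
  exact: hol_at_cst.
have -> : (fun z => f z ^+ n.+1) = (fun x => f x * f x ^+ n).
  by apply/funext => x; rewrite exprS.
exact: hol_atM.
Qed.

Lemma hol_atV f z : f z != 0 -> hol_at f z -> hol_at (fun z => (f z)^-1) z.
Proof. by move=> fz /hol_atP hf; apply/hol_atP; exact: derivableV fz hf. Qed.

Lemma has_cderiv_near f g z d (r : R) : 0 < r ->
  (forall h, normc h < r -> f (z + h) = g (z + h)) -> has_cderiv f z d -> has_cderiv g z d.
Proof.
move=> r0 fg df e e0; have [s s0 H] := df e e0.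
exists (Num.min r s); first by rewrite lt_min r0.
move=> h; rewrite lt_min => /andP[hr hs].
have fgz : f z = g z by rewrite -[z]addr0 fg // normc0.
by rewrite -fg // -fgz H.
Qed.

Lemma antideriv_hline F g (y : R) :
  (forall t, has_cderiv F (Complex t y) (g (Complex t y))) ->
  antideriv (hline F y) (hline g y).
Proof.
move=> dF t; split; apply: is_derive_real_eps => e e0; have [r r0 H] := dF t e e0;
  exists r => // h hr; have := H (h%:C)%C; rewrite normc_real => /(_ hr);
  (have -> : Complex t y + (h%:C)%C = Complex (t + h) y :> R[i]
    by apply/eqP; rewrite eq_complex /= addr0 !eqxx); rewrite /hline => Hh.
- apply: le_trans Hh; apply: le_trans (normc_ge_absRe _).
  by rewrite !ReB ReM /= mulr0 subr0.
- apply: le_trans Hh; apply: le_trans (normc_ge_absIm _).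
  by rewrite !ImB ImM /= mulr0 add0r.
Qed.

(** Along a vertical line dz = i dt, whence the factor - i = 1 / i. *)
Lemma antideriv_vline F g (x : R) :
  (forall t, has_cderiv F (Complex x t) (g (Complex x t))) ->
  antideriv (vline (fun z => - 'i%C * F z) x) (vline g x).
Proof.
move=> dF t; split; apply: is_derive_real_eps => e e0; have [r r0 H] := dF t e e0;
  exists r => // h hr; have := H ('i%C * (h%:C)%C);
  rewrite normcM normc_i mul1r normc_real => /(_ hr);
  (have -> : Complex x t + 'i%C * (h%:C)%C = Complex x (t + h) :> R[i]
    by apply/eqP; rewrite eq_complex /= !mulr0 !mul0r subr0 addr0 mul1r add0r !eqxx);
  rewrite /vline => Hh.
- apply: le_trans Hh; apply: le_trans (normc_ge_absIm _).
  rewrite le_eqVlt; apply/orP; left; apply/eqP; congr `| _ |.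
  by rewrite !ImB ImM ReM !ReM !ImM /=; ring.
- apply: le_trans Hh; apply: le_trans (normc_ge_absRe _).
  rewrite le_eqVlt; apply/orP; left; rewrite -normrN; apply/eqP; congr `| _ |.
  by rewrite !ReB ReM ImM !ImM !ReM /=; ring.
Qed.

End Hol.

(** * Expansion of the Cauchy kernel on a square *)

Section Square.
Variable R : realType.
Implicit Types (f g F : R[i] -> R[i]) (z w d : R[i]) (r : R).

(** This set contains the full lines that carry the sides of the square, because
    the antiderivatives are taken along whole lines. *)
Definition onsq r z : Prop := `|complex.Re z| = r \/ `|complex.Im z| = r.
Definition sqint r g : R[i] := rectint g (- r) r (- r) r.

Lemma sq_rectcont r g : 0 < r -> (forall z, onsq r z -> hol_at g z) ->
  rectcont g (- r) r (- r) r.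
Proof.
move=> r0 hg; have rr : `|r| = r by rewrite gtr0_norm.
by split; [apply: curve_cont_hline|apply: curve_cont_vline|
  apply: curve_cont_hline|apply: curve_cont_vline] => t;
  apply: hol_at_cont_at; apply: hg; rewrite /onsq /= ?normrN rr; [right|left|right|left].
Qed.

Lemma sqint_eq r f g : 0 < r -> (forall z, onsq r z -> f z = g z) -> sqint r f = sqint r g.
Proof.
move=> r0 fg; have rr : `|r| = r by rewrite gtr0_norm.
rewrite /sqint /rectint; congr (_ + _ * _ - _ - _ * _); apply: eq_curve_int => t;
  apply: fg; rewrite /onsq /= ?normrN rr; by [left|right].
Qed.

Lemma sqint_exact r F g : 0 < r -> (forall z, onsq r z -> has_cderiv F z (g z)) ->
  (forall z, onsq r z -> hol_at g z) -> sqint r g = 0.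
Proof.
move=> r0 dF hg; have [c1 c2 c3 c4] := sq_rectcont r0 hg.
have rr : `|r| = r by rewrite gtr0_norm.
rewrite /sqint /rectint (@curve_intE _ _ (hline F (- r)) _ _ c1); last first.
  by apply: antideriv_hline => t; apply: dF; right; rewrite /= normrN rr.
rewrite (@curve_intE _ _ (hline F r) _ _ c3); last first.
  by apply: antideriv_hline => t; apply: dF; right; rewrite /= rr.
rewrite (@curve_intE _ _ (vline (fun z => - 'i%C * F z) r) _ _ c2); last first.
  by apply: antideriv_vline => t; apply: dF; left; rewrite /= rr.
rewrite (@curve_intE _ _ (vline (fun z => - 'i%C * F z) (- r)) _ _ c4); last first.
  by apply: antideriv_vline => t; apply: dF; left; rewrite /= normrN rr.
rewrite /hline /vline.
have L (u v : R[i]) : 'i%C * (- 'i%C * u - - 'i%C * v) = u - v.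
  have -> : 'i%C * (- 'i%C * u - - 'i%C * v) = - ('i%C ^+ 2) * (u - v) by ring.
  by rewrite sqr_i opprK mul1r.
by rewrite !L; ring.
Qed.

Lemma onsq_far r z w : 0 < r -> onsq r z -> normc w <= r / 2 -> r / 2 <= normc (z - w).
Proof.
move=> r0 [zr|zr] wr.
- apply: le_trans (normc_ge_absRe _); rewrite ReB.
  have := lerB_dist (complex.Re z) (complex.Re w).
  by have := normc_ge_absRe w; rewrite zr; lra.
- apply: le_trans (normc_ge_absIm _); rewrite ImB.
  have := lerB_dist (complex.Im z) (complex.Im w).
  by have := normc_ge_absIm w; rewrite zr; lra.
Qed.

Lemma onsq_ge r z : onsq r z -> r <= normc z.
Proof. by move=> [<-|<-]; [exact: normc_ge_absRe|exact: normc_ge_absIm]. Qed.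

Lemma onsq_neq r z w : 0 < r -> onsq r z -> normc w <= r / 2 -> z - w != 0.
Proof.
move=> r0 zr wr; have := onsq_far r0 zr wr; apply: contraTneq => ->.
by rewrite normc0; lra.
Qed.

Lemma onsq_neq0 r z : 0 < r -> onsq r z -> z != 0.
Proof.
by move=> r0 zr; have := @onsq_neq r z 0 r0 zr; rewrite subr0 normc0; apply; lra.
Qed.

Lemma sqint_bound r g M : 0 < r -> (forall z, onsq r z -> hol_at g z) ->
  (forall z, onsq r z -> normc z <= 2 * r -> normc (g z) <= M) ->
  normc (sqint r g) <= 16 * r * M.
Proof.
move=> r0 hg gM; have rr : `|r| = r by rewrite gtr0_norm.
have -> : 16 * r * M = 4 * M * ((r - - r) + (r - - r)) by ring.
apply: rectint_bound; [exact: sq_rectcont | lra | lra |].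
move=> x y xr yr o; apply: gM.
- move: o => /orP[/orP[/orP[]|]|] /eqP ->; rewrite /onsq /= ?normrN rr; by [left|right].
- apply: (le_trans (normc_le_absD _)) => /=.
  have : `|x| <= r by rewrite ler_norml.
  have : `|y| <= r by rewrite ler_norml.
  lra.
Qed.

Section Expansion.
Variables (r : R) (r0 : 0 < r).

(** On the square,
    1 / (z - w) = sum_(k < n) w^k / z^(k+1) + (w / z)^n / (z - w); the remainder
    kernel is the last term times f z. *)
Definition remainder_kernel f w n z := f z * (w ^+ n / (z ^+ n * (z - w))).
Definition cauchy_coef f n := sqint r (fun z => f z / z ^+ n.+1).
Definition cauchy_rem f w n := sqint r (remainder_kernel f w n).

Lemma hol_at_cauchy_coef f n z : hol_at f z -> onsq r z -> hol_at (fun z => f z / z ^+ n.+1) z.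
Proof.
move=> hf zr; apply: hol_atM => //; apply: hol_atV.
  by rewrite expf_neq0 // (onsq_neq0 r0 zr).
by apply: hol_atX; exact: hol_at_id.
Qed.

Lemma hol_at_remainder_kernel f w n z : hol_at f z -> onsq r z ->
  normc w <= r / 2 -> hol_at (remainder_kernel f w n) z.
Proof.
move=> hf zr wr; apply: hol_atM => //; apply: hol_atM; first exact: hol_at_cst.
apply: hol_atV; first by rewrite mulf_neq0 ?(onsq_neq r0 zr) // expf_neq0 // (onsq_neq0 r0 zr).
apply: hol_atM; first by apply: hol_atX; exact: hol_at_id.
by apply: hol_atB; [exact: hol_at_id|exact: hol_at_cst].
Qed.

Lemma cauchy_remS f w n : (forall z, onsq r z -> hol_at f z) -> normc w <= r / 2 ->
  cauchy_rem f w n = w ^+ n * cauchy_coef f n + cauchy_rem f w n.+1.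
Proof.
move=> hf wr; rewrite /cauchy_rem /cauchy_coef /sqint.
rewrite -rectintZD.
- apply: sqint_eq => // z zr; have z0 := onsq_neq0 r0 zr; have zw := onsq_neq r0 zr wr.
  rewrite /remainder_kernel !exprS; have : z ^+ n != 0 by rewrite expf_neq0.
  move: (z ^+ n) (w ^+ n) (f z) => u v s u0.
  by field; rewrite z0 zw u0.
- by apply: sq_rectcont => // z zr; apply: hol_at_cauchy_coef => //; exact: hf.
- by apply: sq_rectcont => // z zr; apply: hol_at_remainder_kernel => //; exact: hf.
Qed.

Lemma cauchy_rem_sum f w n : (forall z, onsq r z -> hol_at f z) -> normc w <= r / 2 ->
  cauchy_rem f w 0 = \sum_(k < n) w ^+ k * cauchy_coef f k + cauchy_rem f w n.
Proof.
move=> hf wr; elim: n => [|n IH]; first by rewrite big_ord0 add0r.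
by rewrite big_ord_recr /= IH (cauchy_remS n hf wr) addrA.
Qed.

Lemma cauchy_rem_bound f w n M : (forall z, onsq r z -> hol_at f z) -> normc w <= r / 2 ->
  (forall z, normc z <= 2 * r -> normc (f z) <= M) ->
  normc (cauchy_rem f w n) <= 32 * M * (normc w / r) ^+ n.
Proof.
move=> hf wr fM.
have M0 : 0 <= M.
  by apply: le_trans (normc_ge0 _) (fM 0 _); rewrite normc0; have := r0; lra.
have -> : 32 * M * (normc w / r) ^+ n = 16 * r * (M * (normc w ^+ n / (r ^+ n * (r / 2)))).
  have := expf_neq0 n (lt0r_neq0 r0); rewrite expr_div_n; move: (r ^+ n) (_ ^+ n) => u v u0.
  by field; rewrite u0 lt0r_neq0.
apply: sqint_bound => // [z zr|z zr z2].
  by apply: hol_at_remainder_kernel => //; exact: hf.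
rewrite /remainder_kernel normcM normcM normcV normcM !normcX.
apply: ler_pM; rewrite ?normc_ge0 //.
- by rewrite mulr_ge0 ?exprn_ge0 ?normc_ge0 // invr_ge0 mulr_ge0 ?exprn_ge0 ?normc_ge0.
- exact: fM.
- apply: ler_wpM2l; first by rewrite exprn_ge0 ?normc_ge0.
  have z0 : 0 < normc z by apply: lt_le_trans (onsq_ge zr).
  have zw : r / 2 <= normc (z - w) by exact: onsq_far.
  rewrite lef_pV2; last 2 first.
  + by rewrite posrE mulr_gt0 ?exprn_gt0 //; have := r0; lra.
  + by rewrite posrE mulr_gt0 ?exprn_gt0 //; have := r0; lra.
  apply: ler_pM => //; [exact/exprn_ge0/ltW | by have := r0; lra |].
  by apply: lerXn2r; rewrite ?nnegrE ?normc_ge0 //; [exact: ltW | exact: onsq_ge].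
Qed.

Lemma cauchy_coef_bound f n M : (forall z, onsq r z -> hol_at f z) ->
  (forall z, normc z <= 2 * r -> normc (f z) <= M) ->
  normc (cauchy_coef f n) <= 16 * M / r ^+ n.
Proof.
move=> hf fM.
have M0 : 0 <= M.
  by apply: le_trans (normc_ge0 _) (fM 0 _); rewrite normc0; have := r0; lra.
have -> : 16 * M / r ^+ n = 16 * r * (M / r ^+ n.+1).
  have := expf_neq0 n (lt0r_neq0 r0); rewrite exprS; move: (r ^+ n) => u u0.
  by field; rewrite u0 lt0r_neq0.
apply: sqint_bound => // [z zr|z zr z2]; first by apply: hol_at_cauchy_coef => //; exact: hf.
rewrite normcM normcV normcX; apply: ler_pM; rewrite ?normc_ge0 //.
- by rewrite invr_ge0 exprn_ge0 ?normc_ge0.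
- exact: fM.
- have z0 : 0 < normc z by apply: lt_le_trans (onsq_ge zr).
  rewrite lef_pV2 ?posrE ?exprn_gt0 //.
  by apply: lerXn2r; rewrite ?nnegrE ?normc_ge0 //; [exact: ltW | exact: onsq_ge].
Qed.

(** Equal to 2 i pi. *)
Definition winding_int : R[i] := cauchy_coef (fun=> 1) 0.

(** Unlike 1 / z, the function z^-(k+2) has a primitive off 0. *)
Lemma cauchy_coef_cst1 k : cauchy_coef (fun=> 1) k.+1 = 0.
Proof.
apply: (@sqint_exact r (fun z => - (k.+1%:R)^-1 * (z ^+ k.+1)^-1)) => // z zr; last first.
  by apply: hol_at_cauchy_coef => //; exact: hol_at_cst.
have z0 := onsq_neq0 r0 zr.
have k0 : (k.+1%:R : R[i]) != 0 by rewrite pnatr_eq0.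
apply/has_cderivP.
have zk : (z : Cplx R) ^+ k.+1 != 0 by rewrite expf_neq0.
have dX : is_derive (z : Cplx R) (1 : Cplx R) (fun x : Cplx R => x ^+ k.+1) (k.+1%:R * z ^+ k).
  by split; [exact: exprn_derivable | rewrite exp_derive /GRing.scale /= mulr1 mulr_natl].
have dV : is_derive (z : Cplx R) (1 : Cplx R) (fun x : Cplx R => (x ^+ k.+1)^-1)
    (- ((z ^+ k.+1) ^- 2) * (k.+1%:R * z ^+ k)).
  split; first by apply: derivableV => //; exact: ex_derive.
  by rewrite deriveV //= derive_val.
have := is_deriveZ (- (k.+1%:R)^-1 : Cplx R) dV.
congr (is_derive _ _ _ _).
rewrite /GRing.scale /= mul1r.
have : z ^+ k != 0 by rewrite expf_neq0.
rewrite !exprS expr0 mulr1; move: (z ^+ k) (k.+1%:R : R[i]) k0 z0 => u v v0 z0 u0.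
by field; rewrite z0 u0 v0.
Qed.

(** Each side contributes at least 1 to the imaginary part. *)
Lemma winding_int_ge : 4 <= normc winding_int.
Proof.
have h1 z : onsq r z -> hol_at (fun z => 1 / z ^+ 1) z.
  by move=> zr; apply: hol_at_cauchy_coef => //; exact: hol_at_cst.
have [c1 c2 c3 c4] := sq_rectcont r0 h1.
apply: le_trans (normc_ge_absIm _); apply: le_trans (ler_norm _).
rewrite -[winding_int]/(rectint (fun z => 1 / z ^+ 1) (- r) r (- r) r) /rectint.
have rr : - r <= r by have := r0; lra.
have [s1 b1 e1] := curve_int_Im_mvt c1 rr.
have [s2 b2 e2] := curve_int_Re_mvt c2 rr.
have [s3 b3 e3] := curve_int_Im_mvt c3 rr.
have [s4 b4 e4] := curve_int_Re_mvt c4 rr.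
have key s : - r <= s <= r -> 1 <= r / (s ^+ 2 + r ^+ 2) * (r - - r).
  move=> /andP[sr rs].
  have p : 0 < s ^+ 2 + r ^+ 2 by have := sqr_ge0 s; have := exprn_gt0 2 r0; lra.
  have -> : r / (s ^+ 2 + r ^+ 2) * (r - - r) = (2 * r ^+ 2) / (s ^+ 2 + r ^+ 2).
    by field; exact: lt0r_neq0.
  by rewrite ler_pdivlMr // mul1r; nra.
move: e1 e2 e3 e4.
move: (curve_int _ _ _) (curve_int _ _ _) (curve_int _ _ _) (curve_int _ _ _).
move=> A1 A2 A3 A4 e1 e2 e3 e4.
rewrite !ImB !ImD ![ 'i%C * _]mulrC !ImiRe e1 e2 e3 e4.
have k1 := key _ b1; have k2 := key _ b2; have k3 := key _ b3; have k4 := key _ b4.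
have E1 : complex.Im (hline (fun z => 1 / z ^+ 1) (- r) s1) = r / (s1 ^+ 2 + r ^+ 2).
  by rewrite /hline expr1 div1r /= sqrrN mulNr opprK.
have E2 : complex.Re (vline (fun z => 1 / z ^+ 1) r s2) = r / (s2 ^+ 2 + r ^+ 2).
  by rewrite /vline expr1 div1r /= addrC.
have E3 : complex.Im (hline (fun z => 1 / z ^+ 1) r s3) = - (r / (s3 ^+ 2 + r ^+ 2)).
  by rewrite /hline expr1 div1r.
have E4 : complex.Re (vline (fun z => 1 / z ^+ 1) (- r) s4) = - (r / (s4 ^+ 2 + r ^+ 2)).
  by rewrite /vline expr1 div1r /= sqrrN mulNr addrC.
rewrite E1 E2 E3 E4.
lra.
Qed.

End Expansion.
End Square.

(** * Limits, completeness and compactness in the complex plane *)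

Section GeneralFacts.
Variable R : realType.

Lemma geo_lt (K e : R) : 0 < e -> exists N, forall n, (N <= n)%N -> K * 2^-1 ^+ n < e.
Proof.
move=> e0; pose K' := `|K| + 1.
have K0 : 0 < K' by have := normr_ge0 K; rewrite /K'; lra.
have Ke : 0 <= K' / e by rewrite divr_ge0 // ltW.
exists (Num.bound (K' / e)) => n Nn.
have n2 : K' / e < 2 ^+ n.
  apply: lt_le_trans (archi_boundP Ke) _; rewrite -natrX ler_nat.
  by apply: (leq_trans Nn); exact/ltnW/ltn_expl.
apply: (@le_lt_trans _ _ (K' * 2^-1 ^+ n)).
  by rewrite ler_wpM2r ?exprn_ge0 ?invr_ge0 // (le_trans (ler_norm K)) // /K'; lra.
by rewrite exprVn ltr_pdivrMr ?exprn_gt0 // mulrC -ltr_pdivrMr.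
Qed.

Lemma eq0_geo_bound (x : R[i]) (K : R) : (forall n, normc x <= K * 2^-1 ^+ n) -> x = 0.
Proof.
move=> H; apply: eq0_normc; apply/eqP; rewrite eq_le normc_ge0 andbT leNgt.
apply/negP => /(geo_lt K) [N /(_ N (leqnn _))].
by rewrite ltNge H.
Qed.

Lemma nat_above (x : R) : exists n : nat, x <= n%:R.
Proof.
exists (Num.bound `|x|).
exact: le_trans (ler_norm _) (ltW (archi_boundP (normr_ge0 _))).
Qed.

Lemma real_complete (u : nat -> R) :
  (forall e : R, 0 < e -> exists N, forall n, (N <= n)%N -> `|u N - u n| < e) ->
  exists l, forall e : R, 0 < e -> exists N, forall n, (N <= n)%N -> `|l - u n| < e.
Proof.
move=> cu.
have /cauchy_cvgP/cvg_ex[l ul] : cauchy (u @ \oo).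
  apply/cauchy_exP => e e0; have [N NP] := cu e e0.
  by exists (u N); exists N => // n Nn; apply: NP.
exists l => e e0; move/cvgrPdist_lt : ul => /(_ e e0)[N _ NP].
by exists N => n Nn; apply: NP.
Qed.

Lemma complex_complete (u : nat -> R[i]) :
  (forall e : R, 0 < e -> exists N, forall n, (N <= n)%N -> normc (u N - u n) < e) ->
  exists l, forall e : R, 0 < e -> exists N, forall n, (N <= n)%N -> normc (l - u n) < e.
Proof.
move=> cu.
have [|a aP] := @real_complete (fun n => complex.Re (u n)).
  move=> e /cu[N NP]; exists N => n Nn; rewrite -ReB.
  exact: le_lt_trans (normc_ge_absRe _) (NP n Nn).
have [|b bP] := @real_complete (fun n => complex.Im (u n)).
  move=> e /cu[N NP]; exists N => n Nn; rewrite -ImB.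
  exact: le_lt_trans (normc_ge_absIm _) (NP n Nn).
exists (Complex a b) => e e0; have e2 : 0 < e / 2 by lra.
have [N1 H1] := aP _ e2; have [N2 H2] := bP _ e2.
exists (maxn N1 N2) => n; rewrite geq_max => /andP[/H1 n1 /H2 n2].
apply: le_lt_trans (normc_le_absD _) _; rewrite ReB ImB /=; lra.
Qed.

Definition box (rho : R) : set (Cplx R) :=
  [set z | `|complex.Re z| <= rho /\ `|complex.Im z| <= rho].

Lemma box_compact rho : compact (box rho).
Proof.
have -> : box rho = (fun p : R * R => Complex p.1 p.2 : Cplx R) @`
    (`[- rho, rho] `*` `[- rho, rho]).
  apply/seteqP; split => [[x y] /= []|_ [[x y] /= [+ + <-]]].
    by rewrite !ler_norml => xr yr; exists (x, y) => //=; split; rewrite in_itv.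
  by rewrite !in_itv /= => xr yr; rewrite /box /= !ler_norml.
apply: continuous_compact; last by apply: compact_setX; exact: segment_compact.
apply: continuous_subspaceT => -[x y]; apply/cvgrPdist_lt => e /pos_complexP[r r0 ->].
have r2 : 0 < r / 2 by lra.
exists (ball x (r / 2), ball y (r / 2)) => /=.
  by split; exact: nbhsx_ballx.
move=> [u v] [/= xu yv].
rewrite norm_normc ltcR; apply: le_lt_trans (normc_le_absD _) _.
rewrite ReB ImB /=; move: xu yv; rewrite /ball /=; lra.
Qed.

Definition cabs (z : Cplx R) : R := normc (z : R[i]).

Lemma normc_continuous : continuous cabs.
Proof.
move=> z; have FF : Filter (nbhs z) by exact: nbhs_filter.
apply/(@cvgrPdist_lt _ R _ _ FF) => e e0.
apply/nbhs_ballP; exists (e%:C)%C => /=; first by rewrite ltcR.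
move=> w; rewrite -ball_normE /= norm_normc ltcR => zw.
apply: le_lt_trans zw; rewrite ler_norml.
have := normcD (z - w : R[i]) w; rewrite subrK.
have := normcD (w - z : R[i]) z; rewrite subrK normcB /cabs.
lra.
Qed.

Lemma compact_normc_bounded (K : set (Cplx R)) : compact K ->
  exists rho : R, forall z, K z -> normc (z : R[i]) <= rho.
Proof.
move=> cK; have [[z0 Kz0]|nK] := pselect (K !=set0); last first.
  by exists 0 => z Kz; case: nK; exists z.
have [||c cin H] := @compact_EVT_max (Cplx R) R cabs K _ cK.
- by exists z0.
- by apply: continuous_subspaceT; exact: normc_continuous.
by exists (normc (c : R[i])) => z Kz; apply: H; rewrite inE.
Qed.

Lemma cont_continuous (f : Cplx R -> Cplx R) : cont f -> continuous f.
Proof.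
move=> cf z; have FF : Filter (nbhs z) by exact: nbhs_filter.
apply/(@cvgrPdist_lt _ (Cplx R) _ _ FF) => e /pos_complexP[r r0 ->].
have [s s0 H] := cf z r r0.
apply/nbhs_ballP; exists (s%:C)%C => /=; first by rewrite ltcR.
move=> w; rewrite -ball_normE /= !norm_normc !ltcR => zw.
have H1 := H ((w : R[i]) - z); rewrite subrKC in H1.
rewrite (@normcB R (f z) (f w)); apply: H1; rewrite (@normcB R w z); exact: zw.
Qed.

Lemma cont_bounded (f : R[i] -> R[i]) (rho : R) : cont f ->
  exists M, forall z, normc z <= rho -> normc (f z) <= M.
Proof.
move=> cf; have [|M MP] := @compact_normc_bounded ((f : Cplx R -> Cplx R) @` box rho).
  apply: continuous_compact; last exact: box_compact.
  by apply: continuous_subspaceT; exact: cont_continuous.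
exists M => z zr; apply: MP; exists z => //; split.
  exact: le_trans (normc_ge_absRe _) zr.
exact: le_trans (normc_ge_absIm _) zr.
Qed.

End GeneralFacts.

(** * Taylor expansion of entire functions *)

Section Cauchy.
Variable R : realType.
Implicit Types (f g : R[i] -> R[i]) (z w d : R[i]) (r M : R).

(** Pointwise counterpart of [entire], see [entire_hol]. *)
Definition hol f := forall z, hol_at f z.

Lemma entire_hol (f : Cplx R -> Cplx R) : entire f <-> hol f.
Proof. by split=> H z; apply/hol_atP; exact: H. Qed.

Lemma hol_cont f : hol f -> cont f.
Proof. by move=> ef z; exact: hol_at_cont_at. Qed.

(** At z = w the value d = f' w makes the quotient continuous, which is what
    [goursat_exceptional] asks for. *)
Definition diff_quotient f w d z := if z == w then d else (f z - f w) / (z - w).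

Lemma diff_quotient_hol_at f w d z : hol f -> z != w -> hol_at (diff_quotient f w d) z.
Proof.
move=> ef zw; have zw0 : z - w != 0 by rewrite subr_eq0.
have [k dk] : hol_at (fun z => (f z - f w) / (z - w)) z.
  apply: hol_atM; first by apply: hol_atB; [exact: ef|exact: hol_at_cst].
  by apply: hol_atV => //; apply: hol_atB; [exact: hol_at_id|exact: hol_at_cst].
exists k; apply: (@has_cderiv_near _ _ _ _ _ (normc (z - w)) _ _ dk).
  by rewrite normc_gt0.
move=> h hzw; rewrite /diff_quotient ifN //; apply: contraTneq hzw => <-.
by rewrite opprD addNKr normc_opp ltxx.
Qed.

Lemma diff_quotient_cont f w d : hol f -> has_cderiv f w d -> cont (diff_quotient f w d).
Proof.
move=> ef df z; have [->|zw] := eqVneq z w; last first.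
  by apply: hol_at_cont_at; exact: diff_quotient_hol_at.
move=> e e0.
have e2 : 0 < e / 2 by lra.
have [r r0 H] := df _ e2; exists r => // h /H; rewrite /diff_quotient eqxx.
have [_|hn] := eqVneq (w + h) w; first by rewrite subrr normc0.
rewrite [w + h]addrC addrK.
have h0 : h != 0 by apply: contra_neq hn => ->; rewrite addr0.
have hp : 0 < normc h.
  by rewrite normc_gt0.
have -> : (f (h + w) - f w) / h - d = (f (h + w) - f w - d * h) / h by field.
rewrite normcM normcV => H1; apply: (@le_lt_trans _ _ (e / 2)); last by lra.
by rewrite ler_pdivrMr.
Qed.

(** For the constant 1 only the k = 0 term of the expansion survives, and the
    remainder tends to 0. *)
Lemma cauchy_rem_cst1 r w : 0 < r -> normc w <= r / 2 ->
  cauchy_rem r (fun=> 1) w 0 = winding_int r.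
Proof.
move=> r0 wr; apply/eqP; rewrite -subr_eq0; apply/eqP.
apply: (@eq0_geo_bound _ _ 32) => n.
have h1 z : onsq r z -> hol_at (fun=> 1) z by move=> _; exact: hol_at_cst.
rewrite (cauchy_rem_sum r0 n.+1 h1 wr) big_ord_recl /= expr0 mul1r big1 ?addr0; last first.
  by move=> i _; rewrite /= cauchy_coef_cst1 // mulr0.
rewrite addrAC subrr add0r.
apply: (le_trans (@cauchy_rem_bound _ _ r0 (fun=> 1) w n.+1 1 h1 wr _)).
  by move=> z _; rewrite normc1.
rewrite mulr1 ler_wpM2l //.
have wr2 : 0 <= normc w / r <= 2^-1.
  apply/andP; split; first by rewrite divr_ge0 ?normc_ge0 // ltW.
  by rewrite ler_pdivrMr // mulrC.
move: wr2 => /andP[w1 w2]; rewrite exprS.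
apply: (@le_trans _ _ (1 * (normc w / r) ^+ n)).
  by rewrite ler_wpM2r ?exprn_ge0 //; lra.
by rewrite mul1r lerXn2r // nnegrE; lra.
Qed.

(** The integral of the difference quotient of f at w vanishes, i.e.
    the integral of f z / (z - w) is f w times the winding integral; then expand
    1 / (z - w).  The bound on the disc of radius 2 r covers the square of
    half-side r. *)
Lemma cauchy_expansion f r M : 0 < r -> hol f ->
  (forall z, normc z <= 2 * r -> normc (f z) <= M) ->
  exists beta : nat -> R[i], (forall k, normc (beta k) <= 4 * M / r ^+ k) /\
    forall n w, normc w <= r / 2 ->
      normc (f w - \sum_(k < n) beta k * w ^+ k) <= 8 * M * (normc w / r) ^+ n.
Proof.
move=> r0 ef fM.
have M0 : 0 <= M.
  by apply: le_trans (normc_ge0 _) (fM 0 _); rewrite normc0; lra.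
have hf z : onsq r z -> hol_at f z by move=> _; exact: ef.
have h1 z : onsq r z -> hol_at (fun=> 1 : R[i]) z by move=> _; exact: hol_at_cst.
pose c := winding_int r; have c4 : 4 <= normc c by exact: winding_int_ge.
have c0 : c != 0 by apply: contraTneq c4 => ->; rewrite normc0 -ltNge.
have cgt : 0 < normc c by lra.
exists (fun k => cauchy_coef r f k / c); split=> [k|n w wr].
  rewrite normcM normcV ler_pdivrMr //.
  have := cauchy_coef_bound r0 k hf fM; move/le_trans; apply.
  have -> : 4 * M / r ^+ k * normc c = (4 * (M / r ^+ k)) * normc c by rewrite mulrA.
  have -> : 16 * M / r ^+ k = (4 * (M / r ^+ k)) * 4 by ring.
  by rewrite ler_wpM2l // mulr_ge0 // divr_ge0 // exprn_ge0 // ltW.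
have main : cauchy_rem r f w 0 = f w * c.
  have [d df] := ef w.
  have sq0 : sqint r (diff_quotient f w d) = 0.
    apply: (@goursat_exceptional _ _ _ _ _ _ (complex.Re w) (complex.Im w)).
    - by have := normc_ge_absRe w; have := ler_norm (complex.Re w);
        have := ler_norm (- complex.Re w); rewrite normrN; lra.
    - by have := normc_ge_absIm w; have := ler_norm (complex.Im w);
        have := ler_norm (- complex.Im w); rewrite normrN; lra.
    - exact: diff_quotient_cont.
    - by move=> z zw; apply: diff_quotient_hol_at => //; move: zw; case: (w).
  have : sqint r (diff_quotient f w d) =
      (- f w) * cauchy_rem r (fun=> 1) w 0 + cauchy_rem r f w 0.
    rewrite /cauchy_rem /sqint -rectintZD.
    - apply: sqint_eq => // z zr; have zw := onsq_neq r0 zr wr.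
      rewrite /diff_quotient ifN; last by rewrite -subr_eq0.
      by rewrite /remainder_kernel !expr0; field.
    - by apply: sq_rectcont => // z zr; apply: (hol_at_remainder_kernel r0) => //;
        first [exact: h1 | exact: hf].
    - by apply: sq_rectcont => // z zr; apply: (hol_at_remainder_kernel r0) => //;
        first [exact: h1 | exact: hf].
  rewrite sq0 cauchy_rem_cst1 // -/c => /esym/eqP; rewrite addrC mulNr subr_eq0 => /eqP ->.
  by [].
have -> : f w - \sum_(k < n) cauchy_coef r f k / c * w ^+ k = cauchy_rem r f w n / c.
  apply: (mulIf c0); rewrite divfK // mulrBl -main (cauchy_rem_sum r0 n hf wr) mulr_suml.
  rewrite addrAC -[RHS]add0r; congr (_ + _); apply/eqP; rewrite subr_eq0; apply/eqP.
  by apply: eq_bigr => i _; rewrite mulrAC divfK // mulrC.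
rewrite normcM normcV ler_pdivrMr //.
apply: (le_trans (cauchy_rem_bound r0 n hf wr fM)).
have wr0 : 0 <= (normc w / r) ^+ n by rewrite exprn_ge0 // divr_ge0 ?normc_ge0 // ltW.
have -> : 32 * M * (normc w / r) ^+ n = 8 * M * (normc w / r) ^+ n * 4 by ring.
by rewrite ler_wpM2l // !mulr_ge0.
Qed.

End Cauchy.

(** * Weierstrass theorem and estimates of derivatives *)

Section Entire.
Variable R : realType.
Implicit Types (f g : R[i] -> R[i]) (z w d : R[i]) (r M : R).

Definition cderiv f : R[i] -> R[i] := derive1 (f : Cplx R -> Cplx R).

Lemma has_cderivE f z d : has_cderiv f z d -> cderiv f z = d.
Proof. by move/has_cderivP => [_ v]; rewrite /cderiv derive1E. Qed.

Lemma hol_at_cderiv f z : hol_at f z -> has_cderiv f z (cderiv f z).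
Proof. by move=> [d df]; rewrite (has_cderivE df). Qed.

Lemma has_cderiv_affine f (a b z d : R[i]) : has_cderiv f (a * z + b) d ->
  has_cderiv (fun z => f (a * z + b)) z (a * d).
Proof.
move=> df e e0; have a1 : 0 < normc a + 1 by have := normc_ge0 a; lra.
have e1 : 0 < e / (normc a + 1) by rewrite divr_gt0.
have [r r0 H] := df _ e1; exists (r / (normc a + 1)); first by rewrite divr_gt0.
move=> h; rewrite ltr_pdivlMr // => hr.
have ah : normc (a * h) <= normc h * (normc a + 1).
  by rewrite normcM; have := normc_ge0 h; lra.
have -> : a * (z + h) + b = a * z + b + a * h by ring.
have -> : a * d * h = d * (a * h) by ring.
apply: (le_trans (H _ (le_lt_trans ah hr))).
apply: (@le_trans _ _ (e / (normc a + 1) * (normc h * (normc a + 1)))).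
  by rewrite ler_wpM2l // ltW.
by rewrite mulrA mulrAC divfK // gt_eqF.
Qed.

Lemma hol_affine f (a b : R[i]) : hol f -> hol (fun z => f (a * z + b)).
Proof.
by move=> ef z; have [d df] := ef (a * z + b); eexists; exact: has_cderiv_affine df.
Qed.

Lemma second_order_has_cderiv f z d C r : 0 < r -> (forall h, normc h <= r ->
  normc (f (z + h) - f z - d * h) <= C * normc h ^+ 2) -> has_cderiv f z d.
Proof.
move=> r0 H e e0; pose K := `|C| + 1.
have K0 : 0 < K by have := normr_ge0 C; rewrite /K; lra.
exists (Num.min r (e / K)); first by rewrite lt_min r0 divr_gt0.
move=> h; rewrite lt_min => /andP[/ltW/H hr hK].
apply: (le_trans hr); rewrite expr2 mulrA ler_wpM2r ?normc_ge0 //.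
apply: (@le_trans _ _ (K * normc h)).
  by rewrite ler_wpM2r ?normc_ge0 // (le_trans (ler_norm C)) // /K; lra.
by move: hK; rewrite ltr_pdivlMr // mulrC => /ltW.
Qed.

(** The expansion of order 2 at z exhibits its coefficient of degree 1 as the
    derivative; the quadratic bound on the remainder depends on f only through M,
    which is what makes locally uniform limits work. *)
Lemma cauchy_cderiv f z r M : 0 < r -> hol f ->
  (forall y, normc (y - z) <= 2 * r -> normc (f y) <= M) ->
  normc (cderiv f z) <= 4 * M / r /\
  forall h, normc h <= r / 2 ->
    normc (f (z + h) - f z - cderiv f z * h) <= 8 * M * (normc h / r) ^+ 2.
Proof.
move=> r0 ef fM.
have eg : hol (fun y => f (1 * y + z)) by exact: hol_affine.
have [|beta [b1 b2]] := cauchy_expansion r0 eg (M := M).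
  by move=> y yr; apply: fM; rewrite mul1r addrK.
have beta0 : beta 0%N = f z.
  have := b2 1%N 0; rewrite normc0 big_ord_recl big_ord0 /= expr0 mulr1 addr0 mulr0 add0r.
  rewrite mul0r expr1 mulr0 => /(_ _)/wrap[|H]; first by lra.
  apply/esym/eqP; rewrite -subr_eq0; apply/eqP/eq0_normc/eqP.
  by rewrite eq_le H normc_ge0.
have H2 h : normc h <= r / 2 ->
    normc (f (z + h) - f z - beta 1%N * h) <= 8 * M * (normc h / r) ^+ 2.
  move=> hr; have := b2 2%N h hr.
  rewrite !big_ord_recl big_ord0 /= expr0 mulr1 addr0 expr1 beta0 mul1r [h + z]addrC.
  by rewrite opprD addrA.
have dz : has_cderiv f z (beta 1%N).
  apply: (@second_order_has_cderiv _ _ _ (8 * M / r ^+ 2) (r / 2)); first by lra.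
  move=> h /H2 /le_trans; apply; rewrite expr_div_n.
  by rewrite le_eqVlt; apply/orP; left; apply/eqP; ring.
by rewrite (has_cderivE dz); split; [exact: (b1 1%N) | exact: H2].
Qed.

Definition cvg_on_discs (F : nat -> R[i] -> R[i]) f := forall rho e : R, 0 < e ->
  exists N, forall n, (N <= n)%N -> forall z, normc z <= rho -> normc (F n z - f z) <= e.

Lemma holZD (k : R[i]) f g : hol f -> hol g -> hol (fun z => k * f z + g z).
Proof.
move=> ef eg z; apply: hol_atD; last exact: eg.
by apply: hol_atM; [exact: hol_at_cst | exact: ef].
Qed.

Lemma cderivZD (k : R[i]) f g z : hol f -> hol g ->
  cderiv (fun z => k * f z + g z) z = k * cderiv f z + cderiv g z.
Proof.
move=> ef eg; apply: has_cderivE; apply/has_cderivP.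
have /has_cderivP df := hol_at_cderiv (ef z); have /has_cderivP dg := hol_at_cderiv (eg z).
exact: is_deriveD (is_deriveZ (k : Cplx R) df) dg.
Qed.

(** The derivatives at z form a Cauchy sequence by the Cauchy estimate, and the
    bounds of [cauchy_cderiv], uniform along the sequence, pass to the limit. *)
Lemma weierstrass F f : (forall n, hol (F n)) -> cvg_on_discs F f -> hol f.
Proof.
move=> eF Ff z.
pose rho := normc z + 2.
have inball y : normc (y - z) <= 2 * 1 -> normc y <= rho.
  by move=> yz; have := normcD (y - z) z; rewrite subrK /rho; lra.
have [|d dP] := @complex_complete R (fun n => cderiv (F n) z).
  move=> e e0; have e9 : 0 < e / 16 by lra.
  have [N NP] := Ff rho _ e9; exists N => n Nn.
  have eg : hol (fun y => (-1) * F n y + F N y) by exact: holZD.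
  have [|b _] := @cauchy_cderiv (fun y => (-1) * F n y + F N y) z 1 (e / 8) ltr01 eg.
    move=> y /inball yr.
    have -> : -1 * F n y + F N y = (F N y - f y) - (F n y - f y) by ring.
    have := normcD (F N y - f y) (- (F n y - f y)); rewrite normc_opp.
    by have := NP N (leqnn _) y yr; have := NP n Nn y yr; lra.
  move: b; rewrite cderivZD // mulN1r addrC divr1.
  lra.
have [N1 N1P] := Ff rho 1 ltr01.
have [M0 M0P] := cont_bounded rho (hol_cont (eF N1)).
pose M := M0 + 2.
have MP n y : (N1 <= n)%N -> normc (y - z) <= 2 * 1 -> normc (F n y) <= M.
  move=> nN /inball yr.
  have -> : F n y = (F n y - f y) - (F N1 y - f y) + F N1 y by ring.
  have := normcD (F n y - f y - (F N1 y - f y)) (F N1 y).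
  have := normcD (F n y - f y) (- (F N1 y - f y)); rewrite normc_opp.
  by have := N1P N1 (leqnn _) y yr; have := N1P n nN y yr; have := M0P y yr; rewrite /M; lra.
exists d; apply: (@second_order_has_cderiv _ _ _ (8 * M) (1 / 2)); first by lra.
move=> h hr; apply/ler_addgt0Pr => e e0.
have e4 : 0 < e / 4 by lra.
have [N2 N2P] := Ff rho _ e4; have [N3 N3P] := dP _ e4.
pose n := maxn N1 (maxn N2 N3).
have n1 : (N1 <= n)%N by rewrite leq_maxl.
have n2 : (N2 <= n)%N by rewrite /n maxnCA leq_maxl.
have n3 : (N3 <= n)%N by rewrite /n maxnA leq_maxr.
have [_ /(_ h hr)] := cauchy_cderiv ltr01 (eF n) (fun y => @MP n y n1).
rewrite divr1.
have zr : normc z <= rho by rewrite /rho; lra.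
have zhr : normc (z + h) <= rho by have := normcD z h; rewrite /rho; lra.
have a1 := N2P n n2 z zr; have a2 := N2P n n2 (z + h) zhr; have a3 := N3P n n3.
have -> : f (z + h) - f z - d * h = (F n (z + h) - F n z - cderiv (F n) z * h)
  - (F n (z + h) - f (z + h)) + (F n z - f z) - (d - cderiv (F n) z) * h by ring.
set A := F n (z + h) - _ - _; set B := F n (z + h) - f _; set C := F n z - f z.
move=> AM.
have := normcD (A - B + C) (- ((d - cderiv (F n) z) * h)).
have := normcD (A - B) C; have := normcD A (- B).
rewrite !normc_opp normcM; have := normc_ge0 (d - cderiv (F n) z); have := normc_ge0 h.
nra.
Qed.

(** The derivative is a locally uniform limit of difference quotients, themselves
    entire. *)
Lemma hol_cderiv f : hol f -> hol (cderiv f).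
Proof.
move=> ef.
(* n + 2 rather than n, so that the increment is at most 1/2. *)
pose F (n : nat) z := (n.+2%:R : R[i]) * f (1 * z + n.+2%:R^-1) + (- n.+2%:R) * f z.
have n0 n : (n.+2%:R : R[i]) != 0 by rewrite pnatr_eq0.
apply: (@weierstrass F).
  move=> n; apply: holZD; first exact: hol_affine.
  have -> : (fun z => - n.+2%:R * f z) = (fun z => - n.+2%:R * f z + 0).
    by apply/funext => y; rewrite addr0.
  by apply: holZD => // z; exact: hol_at_cst.
move=> rho e e0.
have [M MP] := cont_bounded (rho + 2) (hol_cont ef).
have [N NP] : exists N, forall n, (N <= n)%N -> 8 * `|M| / n.+2%:R <= e :> R.
  have b0 : 0 <= 8 * `|M| / e by rewrite divr_ge0 ?mulr_ge0 // ltW.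
  exists (Num.bound (8 * `|M| / e)) => n Nn.
  rewrite ler_pdivrMr ?ltr0n // [X in _ <= X]mulrC -ler_pdivrMr //.
  apply: (le_trans (ltW (archi_boundP b0))); rewrite ler_nat.
  by apply: (leq_trans Nn); rewrite -addn2 leq_addr.
exists N => n Nn z zr.
pose h : R[i] := n.+2%:R^-1.
have hE : normc h = n.+2%:R^-1 :> R.
  by rewrite normcV normcMn normc1.
have [|_ /(_ h)] := @cauchy_cderiv f z 1 M ltr01 ef.
  by move=> y yz; apply: MP; have := normcD (y - z) z; rewrite subrK; lra.
rewrite hE divr1 => /(_ _)/wrap[|].
  by rewrite mul1r lef_pV2 ?posrE ?ltr0n // ler_nat.
move=> H.
have -> : F n z - cderiv f z = n.+2%:R * (f (z + h) - f z - cderiv f z * h).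
  rewrite /F /h mul1r.
  have := n0 n; move: (n.+2%:R : R[i]) => k k0.
  by move: (f (z + k^-1)) (f z) (cderiv f z) => u v x; field.
rewrite normcM normcMn normc1.
apply: (@le_trans _ _ (n.+2%:R * (8 * M * n.+2%:R^-1 ^+ 2))).
  by rewrite ler_wpM2l.
apply: le_trans (NP n Nn).
have k0 : (n.+2%:R : R) != 0 by rewrite pnatr_eq0.
have -> : n.+2%:R * (8 * M * n.+2%:R^-1 ^+ 2) = 8 * M / n.+2%:R :> R by field.
by rewrite ler_wpM2r ?invr_ge0 // ler_wpM2l // ler_norm.
Qed.

Definition cderivn k f : R[i] -> R[i] := derive1n k (f : Cplx R -> Cplx R).

Lemma cderivnS k f : cderivn k.+1 f = cderiv (cderivn k f).
Proof. by []. Qed.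

Lemma hol_cderivn k f : hol f -> hol (cderivn k f).
Proof. by move=> ef; elim: k => // k IH; rewrite cderivnS; exact: hol_cderiv. Qed.

Lemma cauchy_cderivn_step f k z s M : 0 < s -> hol f ->
  (forall y, normc (y - z) <= 2 * k%:R * s -> normc (f y) <= M) ->
  normc (cderivn k f z) <= (4 / s) ^+ k * M.
Proof.
move=> s0 ef; elim: k z => [|k IH] z fM.
  by rewrite expr0 mul1r; apply: fM; rewrite subrr normc0 !mulr0 mul0r.
have [|b _] := @cauchy_cderiv (cderivn k f) z s ((4 / s) ^+ k * M) s0 (hol_cderivn k ef).
  move=> y yz; apply: IH => x xy; apply: fM.
  have := normcD (x - y) (y - z); rewrite addrA subrK => /le_trans; apply.
  by rewrite -natr1; lra.
rewrite cderivnS; apply: (le_trans b).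
by rewrite le_eqVlt; apply/orP; left; apply/eqP; rewrite exprS; field; exact: lt0r_neq0.
Qed.

(** Divide the radius delta in k equal parts and apply the first order estimate k
    times.  The bound k^k instead of k! costs only a factor exp(k). *)
Lemma cauchy_cderivn f k z delta M : 0 < delta -> hol f ->
  (forall y, normc (y - z) <= delta -> normc (f y) <= M) ->
  normc (cderivn k f z) <= (8 * k%:R / delta) ^+ k * M.
Proof.
move=> d0 ef fM; case: k => [|k].
  by rewrite !expr0 mul1r; apply: fM; rewrite subrr normc0 ltW.
have k0 : (k.+1%:R : R) != 0 by rewrite pnatr_eq0.
have k1 : 0 < (k.+1%:R : R) by rewrite ltr0n.
have -> : 8 * k.+1%:R / delta = 4 / (delta / (2 * k.+1%:R)).
  by move: (k.+1%:R) k0 => u k0; field; rewrite ?k0 ?lt0r_neq0.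
apply: cauchy_cderivn_step => //; first by rewrite divr_gt0 // mulr_gt0.
move=> y yz; apply: fM; apply: (le_trans yz).
by rewrite mulrC divfK // mulf_neq0 // pnatr_eq0.
Qed.

Lemma nn_le_exp_fact k : (k%:R : R) ^+ k <= expR 1 ^+ k * k`!%:R.
Proof.
elim: k => [|k IH]; first by rewrite !expr0 fact0 mulr1.
have [->|k0] := eqVneq k 0%N.
  by rewrite !expr1 (_ : 1`! = 1%N) // mulr1; have := @expR_ge1Dx R 1; lra.
have kp : (0 : R) < k%:R by rewrite ltr0n lt0n.
have H : (k.+1%:R : R) ^+ k <= k%:R ^+ k * expR 1.
  have -> : k.+1%:R = k%:R * (1 + k%:R^-1) :> R.
    by rewrite mulrDr mulr1 divff ?natr1 // lt0r_neq0.
  rewrite exprMn ler_wpM2l ?exprn_ge0 //.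
  have -> : expR 1 = expR (k%:R^-1) ^+ k :> R.
    by rewrite -expRM_natl divff // lt0r_neq0.
  by rewrite lerXn2r ?nnegrE ?expR_ge0 ?expR_ge1Dx // addr_ge0 // invr_ge0.
rewrite exprS factS natrM exprS.
have -> : expR 1 * expR 1 ^+ k * (k.+1%:R * k`!%:R) =
  k.+1%:R * ((expR 1 ^+ k * k`!%:R) * expR 1) :> R by ring.
rewrite ler_wpM2l //; apply: (le_trans H).
by rewrite ler_wpM2r ?expR_ge0.
Qed.

End Entire.

(** * The convolution operator *)

Section GeometricSeries.
Variable R : realType.
Implicit Types (u : nat -> R[i]).

Lemma geo_series_tail u (K : R) : (forall k, normc (u k) <= K * 2^-1 ^+ k) ->
  forall n m, normc (\sum_(k < n + m) u k - \sum_(k < n) u k) <= 2 * K * 2^-1 ^+ n.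
Proof.
move=> uK n m.
have K0 : 0 <= K by have := uK 0%N; rewrite expr0 mulr1; apply: le_trans; exact: normc_ge0.
suff : normc (\sum_(k < n + m) u k - \sum_(k < n) u k) <=
       2 * K * 2^-1 ^+ n - 2 * K * 2^-1 ^+ (n + m).
  move/le_trans; apply; rewrite lerBlDr lerDl; apply: mulr_ge0; first exact: mulr_ge0.
  by apply: exprn_ge0; rewrite invr_ge0.
elim: m => [|m IH]; first by rewrite addn0 !subrr normc0.
rewrite addnS big_ord_recr /= addrAC; apply: (le_trans (normcD _ _)).
have := uK (n + m)%N; rewrite exprS; move: IH; move: (2^-1 ^+ (n + m)) => x; lra.
Qed.

Lemma geo_series u (K : R) : (forall k, normc (u k) <= K * 2^-1 ^+ k) ->
  forall n, normc (\sum_(k < n) u k - limn (series (u : nat -> Cplx R))) <= 2 * K * 2^-1 ^+ n.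
Proof.
move=> uK; have tail := geo_series_tail uK.
have [|l lP] := @complex_complete R (fun n => \sum_(k < n) u k).
  move=> e e0; have [N NP] := geo_lt (2 * K) e0.
  exists N => n Nn; rewrite normcB -(subnKC Nn).
  exact: le_lt_trans (tail _ _) (NP N (leqnn _)).
have -> : limn (series (u : nat -> Cplx R)) = l.
  apply/cvg_lim; first exact: norm_hausdorff.
  apply/(@cvgrPdist_lt _ (Cplx R)) => e /pos_complexP[r r0 ->].
  have [N NP] := lP r r0; exists N => // n Nn.
  by rewrite norm_normc ltcR /series /= big_mkord; exact: NP.
move=> n; apply/ler_addgt0Pr => e e0; have [N NP] := lP e e0.
have -> : \sum_(k < n) u k - l =
  - ((\sum_(k < n + N) u k - \sum_(k < n) u k) + (l - \sum_(k < n + N) u k)) by ring.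
rewrite normc_opp; apply: (le_trans (normcD _ _)); apply: lerD; first exact: tail.
by apply/ltW/NP; rewrite leq_addl.
Qed.

End GeometricSeries.

Section Operator.
Variables (R : realType) (phi : Cplx R -> Cplx R).
Hypothesis ephi : hol phi.
Hypothesis etphi : exponential_type phi.
Implicit Types (f g : R[i] -> R[i]) (z : R[i]) (M : R).

Let w (k : nat) : R[i] := taylor_coef phi k.

(** Cauchy estimates on the disc of radius k, where phi is at most A exp(B k). *)
Lemma taylor_coef_bound : exists A C : R, [/\ 0 <= A, 0 < C &
  forall k, normc (w k) <= A * C ^+ k / k`!%:R].
Proof.
have [A [B AB]] := etphi.
exists `|A|, (8 * expR `|B|); split; [exact: normr_ge0 | by rewrite mulr_gt0 ?expR_gt0 |].
move=> k; rewrite /w /taylor_coef.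
have -> : normc (derive1n k phi 0 / k`!%:R : R[i]) = normc (cderivn k phi 0) / k`!%:R.
  by rewrite normcM normcV normcMn normc1.
rewrite ler_wpM2r ?invr_ge0 //.
case: k => [|k].
  rewrite expr0 mulr1; have := AB 0.
  rewrite norm_normc lecR /= => /le_trans; apply.
  rewrite expr0n /= addr0 sqrtr0 mulr0 expR0 mulr1.
  exact: ler_norm.
have k0 : 0 < (k.+1%:R : R) by rewrite ltr0n.
apply: (le_trans (@cauchy_cderivn _ phi k.+1 0 k.+1%:R
  (`|A| * expR (`|B| * k.+1%:R)) k0 ephi _)).
  move=> y; rewrite subr0 => yk; have := AB y; rewrite norm_normc lecR => /le_trans; apply.
  apply: (@le_trans _ _ (`|A| * expR (B * complex.Re (`|y : Cplx R|)))).
    by rewrite ler_wpM2r ?expR_ge0 // ler_norm.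
  rewrite ler_wpM2l // ler_expR.
  apply: (@le_trans _ _ (`|B| * normc y)).
    by rewrite ler_wpM2r ?normc_ge0 // ler_norm.
  by rewrite ler_wpM2l.
rewrite mulfK ?lt0r_neq0 // exprMn -expRM_natl [`|B| * _]mulrC.
by rewrite le_eqVlt; apply/orP; left; apply/eqP; ring.
Qed.

(** The factors k^k and k! of the two estimates compensate up to exp(k), so the
    terms decrease geometrically as soon as delta is a large multiple of C; delta
    depends on phi alone. *)
Lemma convop_term_bound : exists A delta : R, [/\ 0 <= A, 0 < delta &
  forall f z M, hol f -> (forall y, normc (y - z) <= delta -> normc (f y) <= M) ->
  forall k, normc (w k * cderivn k f z) <= A * M * 2^-1 ^+ k].
Proof.
have [A [C [A0 C0 wAC]]] := taylor_coef_bound.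
have e0 : 0 < expR 1 :> R by exact: expR_gt0.
exists A, (16 * C * expR 1); split=> //; first by rewrite !mulr_gt0.
move=> f z M ef fM k; set delta := 16 * C * _ in fM *.
have d0 : 0 < delta by rewrite !mulr_gt0.
rewrite normcM.
apply: (@le_trans _ _ (A * C ^+ k / k`!%:R * ((8 * k%:R / delta) ^+ k * M))).
  by apply: ler_pM; rewrite ?normc_ge0 //; exact: cauchy_cderivn.
have M0 : 0 <= M.
  by apply: le_trans (normc_ge0 _) (fM z _); rewrite subrr normc0 ltW.
have kf : 0 < (k`!%:R : R) by rewrite ltr0n fact_gt0.
have -> : A * C ^+ k / k`!%:R * ((8 * k%:R / delta) ^+ k * M) =
    A * M * (2^-1 ^+ k * (k%:R ^+ k / (expR 1 ^+ k * k`!%:R))).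
  have -> : 8 * k%:R / delta = 2^-1 * k%:R / (C * expR 1).
    by rewrite /delta; field; rewrite !lt0r_neq0.
  rewrite !exprMn (exprVn (C * expR 1)) exprMn.
  have : C ^+ k != 0 by rewrite expf_neq0 // lt0r_neq0.
  have : (expR 1 : R) ^+ k != 0 by rewrite expf_neq0 // lt0r_neq0.
  have := lt0r_neq0 kf.
  move: (C ^+ k) (expR 1 ^+ k) (k`!%:R) (2^-1 ^+ k) (k%:R ^+ k) => a b c d e c0 b0 a0.
  by field; rewrite a0 b0 c0.
rewrite ler_wpM2l ?mulr_ge0 // -[X in _ <= X]mulr1 ler_wpM2l ?exprn_ge0 ?invr_ge0 //.
by rewrite ler_pdivrMr ?mulr_gt0 ?exprn_gt0 // mul1r; exact: nn_le_exp_fact.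
Qed.

Definition convop f : R[i] -> R[i] := convolution_op phi f.
Definition convop_partial n f z : R[i] := \sum_(k < n) w k * cderivn k f z.

Lemma convop_approx : exists A delta : R, [/\ 0 <= A, 0 < delta &
  forall f z M, hol f -> (forall y, normc (y - z) <= delta -> normc (f y) <= M) ->
  forall n, normc (convop_partial n f z - convop f z) <= 2 * (A * M) * 2^-1 ^+ n].
Proof.
have [A [delta [A0 d0 H]]] := convop_term_bound.
exists A, delta; split=> // f z M ef fM n.
exact: (geo_series (H f z M ef fM)).
Qed.

Lemma hol_convop_partial n f : hol f -> hol (convop_partial n f).
Proof.
move=> ef; elim: n => [|n IH].
  have -> : convop_partial 0 f = fun=> 0.
    by apply/funext => z; rewrite /convop_partial big_ord0.
  by move=> z; exact: hol_at_cst.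
have -> : convop_partial n.+1 f = fun z => w n * cderivn n f z + convop_partial n f z.
  by apply/funext => z; rewrite /convop_partial big_ord_recr addrC.
by apply: holZD => //; exact: hol_cderivn.
Qed.

Lemma hol_convop f : hol f -> hol (convop f).
Proof.
move=> ef; apply: (@weierstrass _ (fun n => convop_partial n f)) => [n|rho e e0].
  exact: hol_convop_partial.
have [A [delta [A0 d0 H]]] := convop_approx.
have [M MP] := cont_bounded (rho + delta) (hol_cont ef).
have [N NP] := geo_lt (2 * (A * M)) e0.
exists N => n Nn z zr; apply: (le_trans (H f z M ef _ n)); last exact/ltW/NP.
by move=> y yz; apply: MP; have := normcD (y - z) z; rewrite subrK; lra.
Qed.

Lemma cderivnZD n (k : R[i]) f g z : hol f -> hol g ->
  cderivn n (fun z => k * f z + g z) z = k * cderivn n f z + cderivn n g z.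
Proof.
move=> ef eg; elim: n z => [//|n IH] z.
rewrite !cderivnS -cderivZD; [|exact: hol_cderivn|exact: hol_cderivn].
by congr (cderiv _ z); apply/funext => y; exact: IH.
Qed.

Lemma convopZD (k : R[i]) f g z : hol f -> hol g ->
  convop (fun z => k * f z + g z) z = k * convop f z + convop g z.
Proof.
move=> ef eg.
have [A [delta [A0 d0 H]]] := convop_approx.
have [M1 M1P] := cont_bounded (normc z + delta) (hol_cont ef).
have [M2 M2P] := cont_bounded (normc z + delta) (hol_cont eg).
have ek := holZD k ef eg.
have [M3 M3P] := cont_bounded (normc z + delta) (hol_cont ek).
have inb y : normc (y - z) <= delta -> normc y <= normc z + delta.
  by move=> yz; have := normcD (y - z) z; rewrite subrK; lra.
apply/eqP; rewrite -subr_eq0; apply/eqP.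
apply: (@eq0_geo_bound _ _ (2 * (A * M3) + normc k * (2 * (A * M1)) + 2 * (A * M2))) => n.
have h1 := H f z M1 ef (fun y yz => M1P y (inb y yz)) n.
have h2 := H g z M2 eg (fun y yz => M2P y (inb y yz)) n.
have h3 := H _ z M3 ek (fun y yz => M3P y (inb y yz)) n.
have E : convop_partial n (fun z => k * f z + g z) z =
    k * convop_partial n f z + convop_partial n g z.
  rewrite /convop_partial mulr_sumr -big_split /=; apply: eq_bigr => i _.
  by rewrite cderivnZD //; ring.
have -> : convop (fun z => k * f z + g z) z - (k * convop f z + convop g z) =
    - (convop_partial n (fun z => k * f z + g z) z - convop (fun z => k * f z + g z) z)
    + k * (convop_partial n f z - convop f z) + (convop_partial n g z - convop g z).
  by rewrite E; ring.
set X := convop_partial n _ z - _ in h3 *; set Y := convop_partial n f z - _ in h1 *.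
set Z := convop_partial n g z - _ in h2 *.
have := normcD (- X + k * Y) Z; have := normcD (- X) (k * Y).
rewrite normc_opp normcM; have := ler_wpM2l (normc_ge0 k) h1.
move: (2^-1 ^+ n) h2 h3 => e h2 h3; nra.
Qed.

Variables lambda b : Cplx R.

(** [L_op] on functions of the bare type R[i], on which the arithmetic is carried
    out, instead of its normed alias. *)
Definition Lop f : R[i] -> R[i] := L_op lambda b phi f.

Lemma LopE f z : Lop f z = convop f ((lambda : R[i]) * z + b).
Proof. by []. Qed.

Lemma hol_Lop f : hol f -> hol (Lop f).
Proof. by move=> ef; have := hol_affine lambda b (hol_convop ef). Qed.

Lemma LopZD (k : R[i]) f g : hol f -> hol g ->
  Lop (fun z => k * f z + g z) = fun z => k * Lop f z + Lop g z.
Proof. by move=> ef eg; apply/funext => z; rewrite !LopE convopZD. Qed.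

Lemma Lop_bound rho : exists K rho' : R, 0 <= K /\
  forall f M, hol f -> (forall z, normc z <= rho' -> normc (f z) <= M) ->
  forall z, normc z <= rho -> normc (Lop f z) <= K * M.
Proof.
have [A [delta [A0 d0 H]]] := convop_approx.
exists (2 * A), (normc (lambda : R[i]) * rho + normc (b : R[i]) + delta).
split; first by rewrite mulr_ge0.
move=> f M ef fM z zr; rewrite LopE.
have := H f (lambda * z + b) M ef _ 0%N.
rewrite /convop_partial big_ord0 sub0r normc_opp expr0 mulr1 mulrA; apply=> y yz.
apply: fM; have := normcD (y - (lambda * z + b)) (lambda * z + b); rewrite subrK.
have := normcD ((lambda : R[i]) * z) b; rewrite normcM.
have := ler_wpM2l (normc_ge0 (lambda : R[i])) zr.
lra.
Qed.

Lemma hol_iterLop n f : hol f -> hol (iter n Lop f).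
Proof. by move=> ef; elim: n => //= n IH; exact: hol_Lop. Qed.

Lemma iterLopZD n (k : R[i]) f g : hol f -> hol g ->
  iter n Lop (fun z => k * f z + g z) = fun z => k * iter n Lop f z + iter n Lop g z.
Proof.
by move=> ef eg; elim: n => //= n ->; rewrite LopZD //; exact: hol_iterLop.
Qed.

Lemma iterLop_bound n rho : exists K rho' : R, 0 <= K /\
  forall f M, hol f -> (forall z, normc z <= rho' -> normc (f z) <= M) ->
  forall z, normc z <= rho -> normc (iter n Lop f z) <= K * M.
Proof.
elim: n rho => [|n IH] rho.
  by exists 1, rho; split=> // f M ef fM z zr; rewrite mul1r; exact: fM.
have [K1 [r1 [K10 H1]]] := Lop_bound rho; have [K2 [r2 [K20 H2]]] := IH r1.
exists (K1 * K2), r2; split; first exact: mulr_ge0.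
move=> f M ef fM z zr; rewrite /= -mulrA; apply: H1 => //; first exact: hol_iterLop.
by move=> y yr; exact: H2.
Qed.

End Operator.

(** * Neighbourhoods for compact convergence *)

Section CompactConvergence.
Variable R : realType.

Definition disc_ball (g : Cplx R -> Cplx R) (rho e : R) : set (Cplx R -> Cplx R) :=
  [set h | forall z : R[i], normc z <= rho -> normc (h z - g z : R[i]) <= e].

Lemma disc_ball_nbhs (g : Cplx R -> Cplx R) (rho e : R) : 0 < e ->
  nbhs (g : compact_conv R) (disc_ball g rho e).
Proof.
move=> e0.
pose E : set (Cplx R * Cplx R) := [set xy | ball xy.1 ((e%:C)%C : R[i]) xy.2].
have entE : entourage E by rewrite -entourage_from_ballE; exists (e%:C)%C => //=; rewrite ltcR.
apply: (filterS _ (@fam_nbhs _ _ compact (box rho) E (g : compact_conv R) entE _)).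
  move=> h hE z zr; have /hE : box rho z.
    by split; [exact: le_trans (normc_ge_absRe _) zr | exact: le_trans (normc_ge_absIm _) zr].
  rewrite /E /= -ball_normE /= norm_normc ltcR => /ltW.
  by rewrite (@normcB R (h z) (g z)).
exact: box_compact.
Qed.

Definition disc_ball_filter (g : Cplx R -> Cplx R) : set_system (Cplx R -> Cplx R) :=
  filter_from [set p : R * R | 0 < p.2] (fun p => disc_ball g p.1 p.2).

Lemma disc_ball_filterP g : Filter (disc_ball_filter g).
Proof.
apply: filter_from_filter; first by exists (0, 1) => /=.
move=> [r1 e1] [r2 e2] /= e10 e20; exists (Num.max r1 r2, Num.min e1 e2) => /=.
  by rewrite lt_min e10.
move=> h H; split=> z zr.
- by have := H z; rewrite le_max zr le_min => /(_ isT)/andP[].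
- by have := H z; rewrite le_max zr orbT le_min => /(_ isT)/andP[].
Qed.

(** A compact set lies in a disc and closed squares are compact, so uniform
    closeness on discs gives a basis of neighbourhoods. *)
Lemma nbhs_disc_ball (g : Cplx R -> Cplx R) (U : set (Cplx R -> Cplx R)) :
  nbhs (g : compact_conv R) U ->
  exists rho e : R, 0 < e /\ disc_ball g rho e `<=` U.
Proof.
have FF := disc_ball_filterP g.
have cv : {family compact, disc_ball_filter g --> g}.
  apply/fam_cvgP => A cA P /uniform_nbhs [E [entE EP]].
  move: entE; rewrite -entourage_from_ballE => -[e0 /= /pos_complexP[e ep ->] eE].
  have [rho rhoP] := compact_normc_bounded cA.
  exists (rho, e / 2) => /=; first by lra.
  move=> h hB; apply: EP => y Ay; apply: eE => /=.
  rewrite -ball_normE /= norm_normc ltcR (@normcB R (g y) (h y)).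
  by apply: le_lt_trans (hB y (rhoP _ Ay)) _; rewrite /=; lra.
move=> /cv [[rho e] /= e0 H]; by exists rho, e.
Qed.

Lemma closure_disc_ball (A : set (Cplx R -> Cplx R)) (g : Cplx R -> Cplx R) :
  (forall rho e : R, 0 < e -> exists2 h, A h & disc_ball g rho e h) ->
  closure (A : set (compact_conv R)) g.
Proof.
move=> H U /nbhs_disc_ball [rho [e [e0 sub]]].
by have [h Ah gh] := H rho e e0; exists h; split => //; exact: sub.
Qed.

End CompactConvergence.

Lemma Lop_continuous_linear (R : realType) (phi : Cplx R -> Cplx R) (lambda b : Cplx R) :
  entire phi -> exponential_type phi -> continuous_linear_op (L_op lambda b phi).
Proof.
move=> /entire_hol ephi et; split.
- by move=> f /entire_hol ef; apply/entire_hol; exact: hol_Lop.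
- move=> a f g /entire_hol ef /entire_hol eg.
  exact: (LopZD ephi et lambda b a ef eg).
- apply/subspace_continuousP => f /entire_hol ef U /nbhs_disc_ball [rho [e [e0 sub]]].
  have [K [rho' [K0 H]]] := Lop_bound ephi et lambda b rho.
  have K1 : 0 < K + 1 by lra.
  have eK : 0 < e / (K + 1) by rewrite divr_gt0.
  have nb := disc_ball_nbhs f rho' eK.
  apply: filterS nb => g fg /entire_hol eg; apply: sub => z zr.
  have ed := holZD (-1) ef eg.
  have := H _ (e / (K + 1)) ed _ z zr.
  rewrite (LopZD ephi et lambda b (-1) ef eg) mulN1r [- _ + _]addrC.
  move=> /(_ _)/wrap[y yr|Hz].
    by rewrite mulN1r [- _ + _]addrC; exact: fg.
  apply: (le_trans Hz); rewrite mulrA ler_pdivrMr //.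
  by rewrite mulrC ler_wpM2l; lra.
Qed.

(** * Right inverses on polynomials *)

(** An infinite upper triangular Toeplitz system with finitely supported
    right-hand side, solved by backward substitution: the tail of y is handled by
    induction and the diagonal coefficient g 0 gives the remaining unknown. *)
Lemma toeplitz_solve (R : realType) (g : nat -> R[i]) : g 0%N != 0 -> forall n,
  exists2 M : R, 0 <= M & forall (y : nat -> R[i]) (B : R),
    (forall t, (n <= t)%N -> y t = 0) -> (forall t, normc (y t) <= B) ->
    exists x : nat -> R[i], [/\ forall t, (n <= t)%N -> x t = 0,
      forall t, normc (x t) <= M * B &
      forall N t, (n <= N)%N -> \sum_(k < N) g k * x (t + k)%N = y t].
Proof.
move=> g0; elim=> [|n [M M0 IH]].
  exists 0 => // y B y0 yB; exists (fun=> 0); split => // [t|N t _].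
    by rewrite normc0 mul0r.
  by rewrite y0 // big1 // => k _; rewrite mulr0.
have ng0 : 0 < normc (g 0%N).
  by rewrite normc_gt0.
pose S : R := \sum_(k < n) normc (g k.+1).
have S0 : 0 <= S by apply: sumr_ge0 => i _; exact: normc_ge0.
pose M' := M + (1 + S * M) / normc (g 0%N).
have q0 : 0 <= (1 + S * M) / normc (g 0%N).
  by apply: divr_ge0; [rewrite addr_ge0 // mulr_ge0 | exact: ltW].
have M'0 : 0 <= M' by rewrite addr_ge0.
exists M' => // y B y0 yB.
have B0 : 0 <= B by apply: le_trans (normc_ge0 _) (yB 0%N).
have [||x [x0 xB xE]] := IH (fun t => y t.+1) B.
- by move=> t nt; exact: y0.
- by move=> t; exact: yB.
pose a := (y 0%N - \sum_(k < n) g k.+1 * x k) / g 0%N.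
exists (fun t => if t is t'.+1 then x t' else a); split.
- by case=> // t nt; exact: x0.
- case=> [|t].
  + rewrite /a normcM normcV ler_pdivrMr //.
    apply: (@le_trans _ _ ((1 + S * M) * B)).
      apply: (le_trans (normcD _ _)); rewrite normc_opp mulrDl mul1r; apply: lerD => //.
      apply: (le_trans (normc_sum _ _)).
      rewrite -mulrA /S mulr_suml; apply: ler_sum => i _.
      by rewrite normcM ler_wpM2l ?normc_ge0.
    have -> : (1 + S * M) * B = (1 + S * M) / normc (g 0%N) * B * normc (g 0%N).
      by field; exact: lt0r_neq0.
    by rewrite ler_wpM2r ?normc_ge0 // ler_wpM2r // /M' lerDr.
  + by apply: (le_trans (xB t)); rewrite ler_wpM2r // /M' lerDl.
- move=> [//|N] [|t] nN.
  + rewrite big_ord_recl /= /a mulrC divfK //.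
    have -> : \sum_(i < N) g (bump 0 i) * x i = \sum_(k < n) g k.+1 * x k.
      rewrite -!(big_mkord xpredT (fun k => g k.+1 * x k)).
      rewrite (big_cat_nat (n := n)) //= [X in _ + X]big_nat_cond.
      by rewrite [X in _ + X]big1 ?addr0 // => i /andP[/andP[ni _] _]; rewrite x0 ?mulr0.
    by rewrite subrK.
  + by rewrite -(xE N.+1 t); [apply: eq_bigr => k _; rewrite addSn | exact: ltnW].
Qed.

Section PolyDeriv.
Variable R : realType.
Implicit Types (p q : {poly R[i]}).

Lemma derivn0E p u : p^`(u).[0] = p`_u *+ u`!.
Proof. by rewrite horner_coef0 coef_derivn addn0 ffactnn. Qed.

Lemma size_le_derivn0 p N : (forall u, (N <= u)%N -> p^`(u).[0] = 0) -> (size p <= N)%N.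
Proof.
move=> H; apply/leq_sizeP => u Nu.
have /eqP := H u Nu; rewrite derivn0E -mulr_natr mulf_eq0 pnatr_eq0.
by rewrite eqn0Ngt fact_gt0 orbF => /eqP.
Qed.

Lemma derivn0_ge_size p u : (size p <= u)%N -> p^`(u).[0] = 0.
Proof. by move=> pu; rewrite derivn0E nth_default // mul0rn. Qed.

(** The polynomial with prescribed derivatives x at 0.  In these coordinates, up
    to powers of lambda, L is a Toeplitz operator. *)
Definition epoly (x : nat -> R[i]) N : {poly R[i]} := \poly_(r < N) (x r / r`!%:R).

Lemma derivn0_epoly x N u : (forall t, (N <= t)%N -> x t = 0) -> (epoly x N)^`(u).[0] = x u.
Proof.
move=> x0; rewrite derivn0E coef_poly; case: ltnP => uN; last by rewrite x0 // mul0rn.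
by rewrite -(mulr_natr (x u / _)) divfK // pnatr_eq0 -lt0n fact_gt0.
Qed.

Lemma epolyK p N : (size p <= N)%N -> epoly (fun u => p^`(u).[0]) N = p.
Proof.
move=> pN; apply/polyP => u; rewrite coef_poly; case: ltnP => uN.
  by rewrite derivn0E -(mulr_natr p`_u) mulfK // pnatr_eq0 -lt0n fact_gt0.
by rewrite nth_default // (leq_trans pN).
Qed.

Lemma horner_derivn0 p (b : R[i]) N : (size p <= N)%N ->
  p.[b] = \sum_(v < N) b ^+ v / v`!%:R * p^`(v).[0].
Proof.
move=> pN; rewrite (horner_coef_wide _ pN); apply: eq_bigr => i _.
rewrite derivn0E -(mulr_natr p`_i) mulrC.
have f0 : (i`!%:R : R[i]) != 0 by rewrite pnatr_eq0 -lt0n fact_gt0.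
by field.
Qed.

Lemma size_derivn_le p n : (size p^`(n) <= size p - n)%N.
Proof.
elim: n => [|n IH]; first by rewrite subn0.
rewrite derivnS; apply: (leq_trans (size_poly _ _)).
by rewrite subnS; case: (size p^`(n)) IH => //= k; case: (size p - n)%N.
Qed.

Lemma derivn_comp_affine p (a b : R[i]) u :
  (p \Po (a *: 'X + b%:P))^`(u) = (a ^+ u) *: (p^`(u) \Po (a *: 'X + b%:P)).
Proof.
elim: u => [|u IH]; first by rewrite expr0 scale1r.
rewrite !derivnS IH derivZ deriv_comp derivD derivZ derivX derivC addr0.
by rewrite alg_polyC mulrC mul_polyC scalerA exprS mulrC.
Qed.

Lemma has_cderiv_horner p z : has_cderiv (fun z => p.[z]) z p^`().[z].
Proof.
elim/poly_ind: p => [|p c IH].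
  have -> : (fun z => (0 : {poly R[i]}).[z]) = fun=> 0 by apply/funext => y; rewrite horner0.
  by rewrite deriv0 horner0; apply/has_cderivP; exact: is_derive_cst.
have -> : (fun z => (p * 'X + c%:P).[z]) = fun z => p.[z] * z + c.
  by apply/funext => y; rewrite !hornerE.
rewrite derivD derivC addr0 derivM derivX mulr1 !hornerE.
apply/has_cderivP; have /has_cderivP dp := IH.
have := is_deriveD (is_deriveM dp (is_derive_id (z : Cplx R) 1))
  (is_derive_cst (c : Cplx R) (z : Cplx R) 1).
congr (is_derive _ _ _ _).
by rewrite addr0 /GRing.scale /= mulr1 addrC mulrC.
Qed.

Lemma hol_horner p : hol (fun z => p.[z]).
Proof. by move=> z; eexists; exact: has_cderiv_horner. Qed.

Lemma cderivn_horner k p : cderivn k (fun z => p.[z]) = (fun z => p^`(k).[z]).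
Proof.
elim: k => [//|k IH]; rewrite cderivnS IH derivnS; apply/funext => z.
by apply: has_cderivE; exact: has_cderiv_horner.
Qed.

End PolyDeriv.

Lemma iter_derivnD (F : comNzRingType) (p : {poly F}) i j : p^`(i)^`(j) = p^`(i + j).
Proof. by rewrite /derivn addnC iterD. Qed.

Lemma power_fact_small (R : realType) (x e : R) : 0 < e ->
  exists N, forall r, (N <= r)%N -> x ^+ r / r`!%:R < e.
Proof.
move=> e0; have /cvgrPdist_lt /(_ e e0) [N _ NP] :=
  cvg_series_cvg_0 (is_cvg_series_exp_coeff x).
exists N => r Nr; have := NP r Nr; rewrite /= sub0r normrN.
by apply: le_lt_trans; exact: ler_norm.
Qed.

Section PolyOperator.
Variables (R : realType) (phi : Cplx R -> Cplx R) (lambda b : R[i]).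
Hypothesis ephi : hol phi.
Hypothesis etphi : exponential_type phi.
Implicit Types (p q : {poly R[i]}).

Let w (k : nat) : R[i] := taylor_coef phi k.

(** phi(D) on polynomials; any N at least the size of p gives the same result, and
    leaving N free lets different polynomials share the same sum. *)
Definition conv_poly p N : {poly R[i]} := \sum_(k < N) w k *: p^`(k).

Lemma conv_poly_wide p N : (size p <= N)%N -> conv_poly p N = conv_poly p (size p).
Proof.
move=> pN; rewrite /conv_poly -!(big_mkord xpredT (fun k => w k *: p^`(k))).
rewrite (big_cat_nat (n := size p)) //= [X in _ + X]big_nat_cond.
rewrite [X in _ + X]big1 ?addr0 // => i /andP[/andP[pi _] _].
by rewrite derivn_poly0 // scaler0.
Qed.

Lemma size_conv_poly p N : (size (conv_poly p N) <= size p)%N.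
Proof.
rewrite /conv_poly; apply: (leq_trans (size_sum _ _ _)); apply/bigmax_leqP => i _.
apply: (leq_trans (size_scale_leq _ _)); apply: (leq_trans (size_derivn_le _ _)).
exact: leq_subr.
Qed.

Lemma convop_horner p z : convop phi (fun z => p.[z]) z = (conv_poly p (size p)).[z].
Proof.
have [A [delta [A0 d0 H]]] := convop_approx ephi etphi.
have [M MP] := cont_bounded (normc z + delta) (hol_cont (hol_horner p)).
have inb y : normc (y - z) <= delta -> normc y <= normc z + delta.
  by move=> yz; have := normcD (y - z) z; rewrite subrK; lra.
have h n := H _ z M (hol_horner p) (fun y yz => MP y (inb y yz)) (size p + n)%N.
apply/esym/eqP; rewrite -subr_eq0; apply/eqP.
apply: (@eq0_geo_bound _ _ (2 * (A * M) * 2^-1 ^+ size p)) => n.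
have := h n; rewrite exprD (mulrA (2 * (A * M))).
suff -> : convop_partial phi (size p + n) (fun z => p.[z]) z =
  (conv_poly p (size p)).[z] by [].
rewrite -(conv_poly_wide (leq_addr n (size p))) /convop_partial /conv_poly horner_sum.
by apply: eq_bigr => k _; rewrite hornerZ cderivn_horner.
Qed.

Definition L_poly p : {poly R[i]} := conv_poly p (size p) \Po (lambda *: 'X + b%:P).

Lemma Lop_horner p : Lop phi lambda b (fun z => p.[z]) = (fun z => (L_poly p).[z]).
Proof.
apply/funext => z; rewrite LopE convop_horner /L_poly horner_comp.
by rewrite hornerD hornerZ hornerX hornerC.
Qed.

Lemma iterLop_horner n p :
  iter n (Lop phi lambda b) (fun z => p.[z]) = (fun z => (iter n L_poly p).[z]).
Proof. by elim: n => //= n ->; rewrite Lop_horner. Qed.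

Lemma L_polyD p q : L_poly (p + q) = L_poly p + L_poly q.
Proof.
pose N := maxn (size (p + q)) (maxn (size p) (size q)).
rewrite /L_poly -comp_polyD.
rewrite -(conv_poly_wide (_ : size (p + q)%R <= N)%N) ?leq_maxl //.
rewrite -(conv_poly_wide (_ : size p <= N)%N); last by rewrite /N maxnCA leq_maxl.
rewrite -(conv_poly_wide (_ : size q <= N)%N); last by rewrite /N maxnA leq_maxr.
by rewrite /conv_poly -big_split /=; congr (_ \Po _);
  apply: eq_bigr => k _; rewrite derivnD scalerDr.
Qed.

Lemma L_poly0 : L_poly 0 = 0.
Proof.
have := L_polyD 0 0; rewrite addr0 => /(congr1 (fun x => x - L_poly 0)).
by rewrite addrK subrr.
Qed.

Lemma iterL_polyD n p q : iter n L_poly (p + q) = iter n L_poly p + iter n L_poly q.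
Proof. by elim: n => //= n ->; rewrite L_polyD. Qed.

Lemma derivn0_conv_poly p N u : (conv_poly p N)^`(u).[0] = \sum_(k < N) w k * p^`(u + k).[0].
Proof.
rewrite /conv_poly; elim: N => [|N IH]; first by rewrite !big_ord0 linear0 horner0.
by rewrite !big_ord_recr /= derivnD hornerD IH derivnZ hornerZ iter_derivnD addnC.
Qed.

(** In the derivatives at 0, L is phi(D), followed by the translation by b, which
    is exp(b D), followed by the dilation, which is diagonal. *)
Lemma derivn0_L_poly p N u : (size p <= N)%N -> (L_poly p)^`(u).[0] =
  lambda ^+ u * \sum_(v < N) b ^+ v / v`!%:R * \sum_(k < N) w k * p^`(u + v + k).[0].
Proof.
move=> pN; rewrite /L_poly -(conv_poly_wide pN) derivn_comp_affine hornerZ horner_comp.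
rewrite hornerD hornerZ hornerX hornerC mulr0 add0r; congr (_ * _).
rewrite (@horner_derivn0 _ _ b N); last first.
  apply: (leq_trans (size_derivn_le _ _)); apply: (leq_trans (leq_subr _ _)).
  exact: leq_trans (size_conv_poly _ _) pN.
by apply: eq_bigr => v _; rewrite iter_derivnD derivn0_conv_poly.
Qed.

Variable m : nat.
Hypothesis m0 : (0 < m)%N.
Hypothesis wlt : forall k, (k < m)%N -> w k = 0.
Hypothesis wm : w m != 0.
Hypothesis lam1 : 1 <= normc lambda.

Lemma size_L_poly p : (size (L_poly p) <= size p - m)%N.
Proof.
apply: size_le_derivn0 => u su; rewrite (derivn0_L_poly u (leqnn _)) big1 ?mulr0 // => v _.
rewrite big1 ?mulr0 // => k _; have [km|mk] := ltnP k m; first by rewrite wlt ?mul0r.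
rewrite derivn0_ge_size ?mulr0 //; move: su; rewrite leq_subLR => /leq_trans; apply.
by rewrite addnC leq_add // leq_addr.
Qed.

Lemma iterL_poly_eq0 n p : (size p <= m * n)%N -> iter n L_poly p = 0.
Proof.
elim: n p => [|n IH] p.
  by rewrite muln0 leqn0 size_poly_eq0 => /eqP ->.
move=> pn; rewrite iterSr; apply: IH; apply: (leq_trans (size_L_poly p)).
by rewrite leq_subLR -mulnS.
Qed.

Lemma iterL_poly_eq0_ge n p : (size p <= n)%N -> iter n L_poly p = 0.
Proof.
move=> pn; apply: iterL_poly_eq0; apply: (leq_trans pn).
by rewrite leq_pmull.
Qed.

(** Invert the three factors of [derivn0_L_poly] one after the other.  The
    dilation is a contraction backwards since |lambda| >= 1; the translation and
    phi(D), the latter divided by D^m, are Toeplitz systems independent of s, so M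
    is uniform in s. *)
Lemma right_inverse_step n : exists2 M : R, 1 <= M & forall s (Y : nat -> R[i]) (B : R),
  (forall t, (t < s)%N || (s + n <= t)%N -> Y t = 0) -> (forall t, normc (Y t) <= B) ->
  exists X : nat -> R[i], [/\
    forall t, (t < s + m)%N || (s + m + n <= t)%N -> X t = 0,
    forall t, normc (X t) <= M * B &
    (size (L_poly (epoly X (s + m + n)) - epoly Y (s + n))%R <= s)%N].
Proof.
pose c (v : nat) : R[i] := b ^+ v / v`!%:R.
have c0 : c 0%N != 0 by rewrite /c expr0 fact0 divr1 oner_eq0.
pose g (k : nat) : R[i] := w (m + k)%N.
have g0 : g 0%N != 0 by rewrite /g addn0.
have [M1 M10 H1] := toeplitz_solve c0 n.
have [M2 M20 H2] := toeplitz_solve g0 n.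
have M12 : 0 <= M1 * M2 by exact: mulr_ge0.
exists (1 + M2 * M1); first by rewrite lerDl mulrC.
move=> s Y B Y0 YB.
have B0 : 0 <= B by apply: le_trans (normc_ge0 _) (YB 0%N).
have l0 : lambda != 0 by apply: contraTneq lam1 => ->; rewrite normc0 -ltNge.
have [||x1 [x10 x1B x1E]] := H1 (fun t => Y (s + t)%N / lambda ^+ (s + t)) B.
- by move=> t nt; rewrite Y0 ?mul0r // leq_add2l nt orbT.
- move=> t; rewrite normcM normcV normcX ler_pdivrMr ?exprn_gt0 //; last by have := lam1; lra.
  apply: (le_trans (YB _)); rewrite -[X in X <= _]mulr1 ler_wpM2l //.
  exact: exprn_ege1.
have [||x2 [x20 x2B x2E]] := H2 x1 (M1 * B) => //.
pose X r := if (r < s + m)%N then 0 else x2 (r - (s + m))%N.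
have X0 t : (s + m + n <= t)%N -> X t = 0.
  move=> h; rewrite /X; case: ltnP => // st; apply: x20.
  by rewrite leq_subRL.
exists X; split.
- by move=> t /orP[h|/X0//]; rewrite /X h.
- move=> t; rewrite /X; case: ifP => _.
    by rewrite normc0 mulr_ge0 // addr_ge0 // mulr_ge0.
  by apply: (le_trans (x2B _)); rewrite mulrA ler_wpM2r // lerDr.
- apply: size_le_derivn0 => u su; rewrite derivnB hornerD hornerN.
  rewrite derivn0_epoly; last by move=> t h; rewrite Y0 // h orbT.
  set N := (s + m + n)%N.
  rewrite (@derivn0_L_poly _ N u) ?size_poly //.
  have [t ut] : exists t, u = (s + t)%N by exists (u - s)%N; rewrite subnKC.
  have inner v : \sum_(k < N) w k * (epoly X N)^`(u + v + k).[0] = x1 (t + v)%N.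
    have -> : N = (m + (s + n))%N by rewrite /N addnA [(s + m)%N]addnC.
    rewrite big_split_ord /= big1 ?add0r; last first.
      by move=> k _; rewrite wlt ?mul0r //= ltn_ord.
    rewrite -(x2E (s + n)%N) ?leq_addl //; apply: eq_bigr => k _.
    rewrite derivn0_epoly; last first.
      by move=> r hr; apply: X0; move: hr; rewrite addnA [(m + s)%N]addnC.
    congr (_ * _); rewrite /X ut.
    have -> : (s + t + v + (m + k) = s + m + (t + v + k))%N by ring.
    by rewrite ltnNge leq_addr /= addKn.
  under eq_bigr => v _ do rewrite inner.
  rewrite (x1E N t) ?leq_addl // ut mulrC divfK ?subrr //.
  by rewrite expf_neq0.
Qed.

(** Iterate [right_inverse_step] with s = m j; the terms of degree < m j that it
    neglects are killed by the j-th iterate of L. *)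
Lemma right_inverse n : exists2 M : R, 1 <= M & forall p, (size p <= n)%N ->
  exists B : R, 0 <= B /\ forall j, exists X : nat -> R[i], [/\
    forall t, (t < m * j)%N || (m * j + n <= t)%N -> X t = 0,
    forall t, normc (X t) <= M ^+ j * B &
    iter j L_poly (epoly X (m * j + n)) = p].
Proof.
have [M M1 H] := right_inverse_step n; exists M => // p pn.
pose B : R := \sum_(u < n) normc (p^`(u).[0]).
have B0 : 0 <= B by apply: sumr_ge0 => i _; exact: normc_ge0.
have pB u : normc (p^`(u).[0]) <= B.
  have [un|nu] := ltnP u n; last by rewrite derivn0_ge_size ?normc0 // (leq_trans pn).
  rewrite /B (bigD1 (Ordinal un)) //= lerDl.
  by apply: sumr_ge0 => i _; exact: normc_ge0.
exists B; split => //; elim=> [|j [X [X0 XB XE]]].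
  exists (fun u => p^`(u).[0]); split.
  - move=> t; rewrite muln0 ltn0 add0n /= => nt; rewrite derivn0_ge_size //.
    exact: leq_trans pn nt.
  - by move=> t; rewrite expr0 mul1r.
  - by rewrite muln0 add0n /= epolyK.
have [Z [Z0 ZB ZE]] := H (m * j)%N X (M ^+ j * B) X0 XB.
exists Z; rewrite mulnS [(m + m * j)%N]addnC; split => //.
  by move=> t; rewrite exprS -mulrA; exact: ZB.
rewrite iterSr -(subrK (epoly X (m * j + n)) (L_poly _)) iterL_polyD XE.
by rewrite iterL_poly_eq0 ?add0r.
Qed.

(** Every degree r in the support is at least j, so M^j <= M^r and the term of
    degree r is at most B (M rho)^r / r!. *)
Lemma epoly_small n (M B rho e : R) : 1 <= M -> 0 <= B -> 0 <= rho -> 0 < e ->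
  exists J, forall j X, (J <= j)%N ->
    (forall t, (t < m * j)%N || (m * j + n <= t)%N -> X t = 0) ->
    (forall t, normc (X t) <= M ^+ j * B) ->
    forall z, normc z <= rho -> normc (epoly X (m * j + n)).[z] <= e.
Proof.
move=> M1 B0 r0 e0.
pose D := n%:R * B + 1.
have D0 : 0 < D by rewrite /D; have := mulr_ge0 (ler0n R n) B0; lra.
have eD : 0 < e / D by rewrite divr_gt0.
have [N NP] := power_fact_small (M * rho) eD.
exists N => j X Nj X0 XB z zr.
rewrite (horner_coef_wide z (size_poly _ _)) big_split_ord /= big1 ?add0r; last first.
  by move=> i _; rewrite coef_poly X0 ?mul0r ?if_same ?mul0r //= ltn_ord.
apply: (le_trans (normc_sum _ _)).
apply: (@le_trans _ _ (\sum_(i < n) (B * (e / D)))); last first.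
  rewrite sumr_const card_ord -mulr_natl mulrA.
  have -> : n%:R * B * (e / D) = (n%:R * B / D) * e by ring.
  rewrite -[X in _ <= X]mul1r ler_wpM2r ?ltW // ltr_pdivrMr //.
  by rewrite mul1r /D ltrDl.
apply: ler_sum => i _.
rewrite coef_poly ltn_add2l ltn_ord; set r := (m * j + i)%N.
have jr : (j <= r)%N by apply: (leq_trans (leq_pmull j m0)); exact: leq_addr.
rewrite !normcM normcV normcMn normc1 normcX.
apply: (@le_trans _ _ (B * ((M * rho) ^+ r / r`!%:R))); last first.
  by rewrite ler_wpM2l // ltW // NP // (leq_trans Nj).
have f0 : 0 <= (r`!%:R : R)^-1 by rewrite invr_ge0.
have -> : B * ((M * rho) ^+ r / r`!%:R) = M ^+ r * B / r`!%:R * rho ^+ r.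
  by rewrite exprMn; ring.
have M0 : 0 <= M by lra.
apply: ler_pM.
- by rewrite mulr_ge0 ?normc_ge0.
- by rewrite exprn_ge0 ?normc_ge0.
- rewrite ler_wpM2r //; apply: (le_trans (XB _)); rewrite ler_wpM2r //.
  by apply: ler_weXn2l.
- by apply: lerXn2r; rewrite ?nnegrE ?normc_ge0.
Qed.

Lemma iterLop_bound_le n (rho : R) : exists K rho' : R, 0 <= K /\
  forall n', (n' <= n)%N ->
  forall f M, 0 <= M -> hol f -> (forall z, normc z <= rho' -> normc (f z) <= M) ->
  forall z, normc z <= rho -> normc (iter n' (Lop phi lambda b) f z) <= K * M.
Proof.
elim: n => [|n [K1 [r1 [K10 H1]]]].
  have [K [r' [K0 H]]] := iterLop_bound ephi etphi lambda b 0 rho.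
  exists K, r'; split => // n'; rewrite leqn0 => /eqP -> f M _; exact: H.
have [K2 [r2 [K20 H2]]] := iterLop_bound ephi etphi lambda b n.+1 rho.
exists (K1 + K2), (Num.max r1 r2); split; first exact: addr_ge0.
move=> n' n'n f M M0 ef fM z zr; rewrite mulrDl.
move: n'n; rewrite leq_eqVlt => /orP[/eqP ->|n'n].
- apply: (@le_trans _ _ (K2 * M)); last by rewrite lerDr mulr_ge0.
  by apply: H2 => // y yr; apply: fM; rewrite le_max yr orbT.
- apply: (@le_trans _ _ (K1 * M)); last by rewrite lerDl mulr_ge0.
  by apply: (H1 n') => // y yr; apply: fM; rewrite le_max yr.
Qed.

(** The preimages given by [right_inverse] tend to 0, and so do their first N
    images by continuity of L. *)
Lemma small_preimage p N (rho e : R) : 0 < e -> exists n q, [/\ (N <= n)%N,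
  iter n L_poly q = p &
  forall n', (n' <= N)%N -> forall z, normc z <= rho ->
    normc (iter n' (Lop phi lambda b) (fun z => q.[z]) z) <= e].
Proof.
move=> e0.
have [K [rho' [K0 HK]]] := iterLop_bound_le N rho.
have [M M1 HM] := right_inverse (size p).
have [B [B0 HB]] := HM p (leqnn _).
have eK : 0 < e / (K + 1) by rewrite divr_gt0 //; lra.
have [J HJ] := @epoly_small (size p) M B `|rho'| (e / (K + 1)) M1 B0 (normr_ge0 _) eK.
have [X [X0 XB XE]] := HB (maxn N J).
exists (maxn N J), (epoly X (m * maxn N J + size p)); split => //; first exact: leq_maxl.
move=> n' n'N z zr.
apply: (@le_trans _ _ (K * (e / (K + 1)))).
  apply: (HK n' n'N) => //; [exact: ltW | exact: hol_horner |].
  move=> y yr; apply: (HJ _ X) => //; first exact: leq_maxr.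
  exact: le_trans yr (ler_norm _).
rewrite mulrA ler_pdivrMr; last by lra.
by rewrite mulrC ler_wpM2l; lra.
Qed.

End PolyOperator.

(** * Non-vanishing Taylor coefficients and dense sequences *)

(** If all derivatives at 0 vanish, so do the coefficients of [cauchy_expansion]:
    for the first nonzero beta k, subtracting beta k z^k from phi leaves
    O(|z|^(k+1)), whose k-th derivative at 0 vanishes by the Cauchy estimates on
    small discs.  Then phi is its own remainder, of every order. *)
Lemma taylor_coef_neq0 (R : realType) (phi : Cplx R -> Cplx R) : hol phi ->
  ~ (exists c : Cplx R, forall z, phi z = c) -> exists k, taylor_coef phi k != 0 :> R[i].
Proof.
move=> ephi nc; apply: contrapT => nk; apply: nc; exists 0 => z.
have t0 k : cderivn k phi 0 = 0.
  apply/eqP; apply: contra_notT nk => H; exists k; rewrite /taylor_coef.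
  by rewrite mulf_neq0 // invr_eq0 pnatr_eq0 -lt0n fact_gt0.
pose r := 2 * normc (z : R[i]) + 1.
have r0 : 0 < r by have := normc_ge0 (z : R[i]); rewrite /r; lra.
have [M MP] := cont_bounded (2 * r) (hol_cont ephi).
have [beta [_ H]] := cauchy_expansion r0 ephi MP.
have beta0 k : beta k = 0.
  have [n nk'] := ubnP k; elim: n k nk' => // n IH k; rewrite ltnS => kn.
  pose p : {poly R[i]} := (- beta k) *: 'X^k.
  have eg : hol (fun y => 1 * phi y + p.[y]) by apply: holZD => //; exact: hol_horner.
  have dg : cderivn k (fun y => 1 * phi y + p.[y]) 0 = - (beta k * k`!%:R).
    rewrite cderivnZD //; last exact: hol_horner.
    rewrite t0 mulr0 add0r cderivn_horner derivn0E coefZ coefXn eqxx mulr1.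
    by rewrite -(mulr_natr (- beta k)) mulNr.
  have gB y : normc y <= r / 2 -> normc (1 * phi y + p.[y]) <= 8 * M * (normc y / r) ^+ k.+1.
    move=> yr; have := H k.+1 y yr; rewrite big_ord_recr /= big1 ?add0r; last first.
      by move=> i _; rewrite IH ?mul0r // (leq_trans _ kn) // ltn_ord.
    by rewrite mul1r /p hornerZ hornerXn mulNr.
  have M0 : 0 <= M by apply: le_trans (normc_ge0 _) (MP 0 _); rewrite normc0; lra.
  have kf : (k`!%:R : R[i]) != 0 by rewrite pnatr_eq0 -lt0n fact_gt0.
  suff : beta k * k`!%:R = 0 by move/eqP; rewrite mulf_eq0 (negbTE kf) orbF => /eqP.
  apply: (@eq0_geo_bound _ _ ((8 * k%:R) ^+ k * (8 * M / r ^+ k.+1) * (r / 2))) => j.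
  pose d := r / 2 * 2^-1 ^+ j.
  have d0 : 0 < d by rewrite mulr_gt0 ?divr_gt0 // exprn_gt0 // invr_gt0.
  have dr : d <= r / 2.
    rewrite /d -[X in _ <= X]mulr1; apply: ler_wpM2l; first by apply/ltW; rewrite divr_gt0.
    by apply: exprn_ile1; lra.
  have := @cauchy_cderivn _ _ k 0 d (8 * M * (d / r) ^+ k.+1) d0 eg _.
  rewrite dg normc_opp => /(_ _)/wrap[y|].
    rewrite subr0 => yd; apply: (le_trans (gB y (le_trans yd dr))).
    rewrite ler_wpM2l ?mulr_ge0 //; apply: lerXn2r; rewrite ?nnegrE.
    - by rewrite divr_ge0 ?normc_ge0 // ltW.
    - by rewrite divr_ge0 // ltW.
    - by rewrite ler_wpM2r ?invr_ge0 // ltW.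
  move/le_trans; apply; rewrite le_eqVlt; apply/orP; left; apply/eqP.
  have -> : (8 * k%:R) ^+ k * (8 * M / r ^+ k.+1) * (r / 2) * 2^-1 ^+ j =
    (8 * k%:R) ^+ k * (8 * M / r ^+ k.+1) * d by rewrite /d; ring.
  rewrite !expr_div_n [d ^+ k.+1]exprS.
  have := expf_neq0 k (lt0r_neq0 d0); have := expf_neq0 k.+1 (lt0r_neq0 r0).
  by move: (d ^+ k) (r ^+ k.+1) ((8 * k%:R) ^+ k) => u v x v0 u0; field; rewrite u0 v0.
apply: (@eq0_geo_bound _ _ (8 * M)) => n.
have zr : normc (z : R[i]) <= r / 2 by rewrite /r; lra.
have M0 : 0 <= M by apply: le_trans (normc_ge0 _) (MP 0 _); rewrite normc0; lra.
have := H n z zr; rewrite big1 ?subr0; last by move=> i _; rewrite beta0 mul0r.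
move/le_trans; apply; rewrite ler_wpM2l ?mulr_ge0 //; apply: lerXn2r; rewrite ?nnegrE.
- by rewrite divr_ge0 ?normc_ge0 // ltW.
- by rewrite invr_ge0.
- by rewrite ler_pdivrMr // mulrC.
Qed.

Section DensePolynomials.
Variable R : realType.

Lemma hol_poly_approx (g : R[i] -> R[i]) (rho e : R) : hol g -> 0 < e ->
  exists p : {poly R[i]}, forall z, normc z <= rho -> normc (g z - p.[z]) <= e.
Proof.
move=> eg e0; pose s := `|rho| + 1.
have s0 : 0 < s by have := normr_ge0 rho; rewrite /s; lra.
have r0 : 0 < 2 * s by lra.
have [M MP] := cont_bounded (2 * (2 * s)) (hol_cont eg).
have M0 : 0 <= M by apply: le_trans (normc_ge0 _) (MP 0 _); rewrite normc0; lra.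
have [beta [_ H]] := cauchy_expansion r0 eg MP.
have [N NP] := geo_lt (8 * M) e0.
exists (\poly_(k < N) beta k) => z zr.
have zs : normc z <= s by have := ler_norm rho; rewrite /s; lra.
rewrite horner_poly; apply: (le_trans (H N z _)); first by lra.
apply: le_trans (ltW (NP N (leqnn _))).
rewrite ler_wpM2l ?mulr_ge0 //; apply: lerXn2r; rewrite ?nnegrE.
- by rewrite divr_ge0 ?normc_ge0 // ltW.
- by rewrite invr_ge0.
- by rewrite ler_pdivrMr //; lra.
Qed.

Definition gauss_rat (c : rat * rat) : R[i] := Complex (ratr c.1) (ratr c.2).
Definition gauss_poly (s : seq (rat * rat)) : {poly R[i]} :=
  foldr (fun c p => p * 'X + (gauss_rat c)%:P) 0 s.

Lemma rat_approx (x e : R) : 0 < e -> exists q : rat, `|x - ratr q| <= e.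
Proof.
move=> e0; have [|q] := @rat_in_itvoo R (x - e) (x + e); first by lra.
by rewrite in_itv /= => /andP[q1 q2]; exists q; rewrite ler_norml; lra.
Qed.

Lemma gauss_poly_approx (p : {poly R[i]}) (rho e : R) : 0 < e ->
  exists s, forall z, normc z <= rho -> normc (p.[z] - (gauss_poly s).[z]) <= e.
Proof.
elim/poly_ind: p e => [|p c IH] e e0.
  by exists [::] => z _; rewrite subrr normc0 ltW.
pose s := `|rho| + 1.
have s0 : 0 < s by have := normr_ge0 rho; rewrite /s; lra.
have es : 0 < e / 2 / s by rewrite divr_gt0 // divr_gt0.
have e4 : 0 < e / 4 by rewrite divr_gt0.
have [l lP] := IH _ es.
have [q1 h1] := rat_approx (complex.Re c) e4; have [q2 h2] := rat_approx (complex.Im c) e4.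
exists ((q1, q2) :: l) => z zr; rewrite /= !hornerE -/(gauss_poly l).
have zs : normc z <= s by have := ler_norm rho; rewrite /s; lra.
have -> : p.[z] * z + c - ((gauss_poly l).[z] * z + gauss_rat (q1, q2)) =
  (p.[z] - (gauss_poly l).[z]) * z + (c - gauss_rat (q1, q2)) by ring.
apply: (le_trans (normcD _ _)); rewrite normcM.
have -> : e = e / 2 / s * s + (e / 4 + e / 4) by field; exact: lt0r_neq0.
apply: lerD; first by apply: ler_pM; rewrite ?normc_ge0 // lP.
apply: (le_trans (normc_le_absD _)); rewrite ReB ImB /=.
exact: lerD.
Qed.

(** Decoding a pair (s, i) and forgetting i makes every polynomial of the list
    recur infinitely often. *)
Definition target (j : nat) : {poly R[i]} :=
  if @unpickle (seq (rat * rat) * nat)%type j is Some c then gauss_poly c.1 else 0.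

Lemma target_often s J : exists2 j, (J <= j)%N & target j = gauss_poly s.
Proof.
have [[i Ji]|H] := pselect (exists i : nat, (J <= pickle (s, i))%N).
  by exists (pickle (s, i)) => //; rewrite /target pickleK.
have lt (i : nat) : (pickle (s, i) < J)%N.
  by rewrite ltnNge; apply/negP => h; apply: H; exists i.
have inj : injective (fun i : 'I_J.+1 => Ordinal (lt i)).
  move=> i1 i2 h; have /(pcan_inj pickleK) : pickle (s, val i1) = pickle (s, val i2).
    by have := congr1 val h.
  by case=> /val_inj.
by have := leq_card _ inj; rewrite !card_ord ltnn.
Qed.

End DensePolynomials.

(** * The hypercyclic vector *)

Section Construction.
Variables (R : realType) (phi : Cplx R -> Cplx R) (lambda b : R[i]).
Hypothesis ephi : hol phi.
Hypothesis etphi : exponential_type phi.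
Variable m : nat.
Hypothesis m0 : (0 < m)%N.
Hypothesis wlt : forall k, (k < m)%N -> taylor_coef phi k = 0.
Hypothesis wm : taylor_coef phi m != 0.
Hypothesis lam1 : 1 <= normc lambda.

Let T := Lop phi lambda b.
Let P := L_poly phi lambda b.

(** Greedy construction: N j bounds all the times and sizes used before step j.
    Choosing n j >= N j makes L^(n j) kill the earlier polynomials, and asking
    the first N j images of q j to be small covers all earlier times. *)
Lemma poly_sequence : exists (n : nat -> nat) (q : nat -> {poly R[i]}), [/\
  forall j, iter (n j) P (q j) = target R j,
  forall i j, (i < j)%N -> iter (n j) P (q i) = 0,
  forall i j, (i < j)%N -> forall z, normc z <= j%:R ->
    normc (iter (n i) P (q j)).[z] <= 2^-1 ^+ j &
  forall j z, normc z <= j%:R -> normc (q j).[z] <= 2^-1 ^+ j].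
Proof.
have step (Nj : nat * nat) : exists nq : nat * {poly R[i]}, [/\ (Nj.1 <= nq.1)%N,
    iter nq.1 P nq.2 = target R Nj.2 &
    forall n', (n' <= Nj.1)%N -> forall z, normc z <= Nj.2%:R ->
      normc (iter n' P nq.2).[z] <= 2^-1 ^+ Nj.2].
  have e0 : 0 < (2^-1 : R) ^+ Nj.2 by rewrite exprn_gt0 // invr_gt0.
  have [n [q [h1 h2 h3]]] := small_preimage b ephi etphi m0 wlt wm lam1
    (target R Nj.2) Nj.1 Nj.2%:R e0.
  exists (n, q); split=> // n' n'N z zr.
  by have := h3 n' n'N z zr; rewrite iterLop_horner //.
have [sg sgP] := choice step.
pose N := fix N j : nat := if j is i.+1 then
  maxn (sg (N i, i)).1 (size (sg (N i, i)).2) else 0%N.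
pose n j := (sg (N j, j)).1; pose q j := (sg (N j, j)).2.
have NS j : N j.+1 = maxn (n j) (size (q j)) by [].
have Nn j : (N j <= n j)%N by have [] := sgP (N j, j).
have Nmono i j : (i <= j)%N -> (N i <= N j)%N.
  apply: (homo_leq leqnn leq_trans) => {}j.
  by rewrite NS; apply: (leq_trans (Nn j)); exact: leq_maxl.
exists n, q; split.
- by move=> j; have [] := sgP (N j, j).
- move=> i j ij; apply: (iterL_poly_eq0_ge _ _ m0 wlt).
  apply: leq_trans (Nn j); apply: leq_trans (Nmono _ _ ij).
  by rewrite NS leq_maxr.
- move=> i j ij z zj; have [_ _ H] := sgP (N j, j); apply: H => //=.
  apply: leq_trans (Nmono _ _ ij).
  by rewrite NS leq_maxl.
- by move=> j z zj; have [_ _ H] := sgP (N j, j); exact: (H 0%N).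
Qed.

Lemma normc_sum_geo (u : nat -> R[i]) i J :
  (forall j, (j < i.+1)%N -> u j = 0) -> (forall j, (i < j)%N -> normc (u j) <= 2^-1 ^+ j) ->
  normc (\sum_(j < J) u j) <= 2 * 2^-1 ^+ i.
Proof.
move=> u0 uB.
have H k : normc (u k) <= 1 * 2^-1 ^+ k.
  have [ki|ik] := ltnP k i.+1; last by rewrite mul1r uB.
  by rewrite u0 // normc0 mul1r exprn_ge0 // invr_ge0.
have z0 : \sum_(j < i) u j = 0 by rewrite big1 // => j _; rewrite u0 // ltnS ltnW.
have [Ji|/ltnW iJ] := leqP J i.
  rewrite big1; first by rewrite normc0 mulr_ge0 // exprn_ge0 // invr_ge0.
  by move=> j _; rewrite u0 // ltnS ltnW // (leq_trans _ Ji).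
have := geo_series_tail H i (J - i); rewrite subnKC // z0 subr0 mulr1.
by [].
Qed.

(** For f = sum q_j, the image L^(n i) f consists of the target of index i, of
    nothing from j < i, and of a geometric tail of size 2^-i from j > i. *)
Lemma hypercyclic_vector : exists2 f, hol f & forall (g : R[i] -> R[i]) (rho e : R),
  hol g -> 0 < e -> exists n, forall z, normc z <= rho -> normc (iter n T f z - g z) <= e.
Proof.
have [n [q [qT q0 qsmall qdecay]]] := poly_sequence.
pose Q J : {poly R[i]} := \sum_(j < J) q j.
have QE J z : (Q J).[z] = \sum_(j < J) (q j).[z] by rewrite /Q horner_sum.
have tail J m' z : normc z <= J%:R -> normc ((Q (J + m')).[z] - (Q J).[z]) <= 2 * 2^-1 ^+ J.
  move=> zJ; rewrite !QE big_split_ord /= addrAC subrr add0r.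
  have H k : normc (q (J + k)%N).[z] <= 2^-1 ^+ J * 2^-1 ^+ k.
    rewrite -exprD; apply: qdecay; apply: (le_trans zJ).
    by rewrite ler_nat leq_addr.
  have := geo_series_tail H 0 m'; rewrite big_ord0 subr0 expr0 mulr1 add0n.
  by [].
have lim_ex z : exists l, forall J, normc z <= J%:R -> normc (l - (Q J).[z]) <= 2 * 2^-1 ^+ J.
  pose J0 := Num.bound (normc z).
  have zJ J : (J0 <= J)%N -> normc z <= J%:R.
    move=> h; apply: (le_trans (ltW (archi_boundP (normc_ge0 z)))).
    by rewrite ler_nat.
  have [|l lP] := @complex_complete R (fun J => (Q J).[z]).
    move=> e e0; have [N NP] := geo_lt 2 e0.
    exists (maxn N J0) => J NJ; rewrite normcB -(subnKC NJ).
    apply: (le_lt_trans (tail _ _ _ (zJ _ (leq_maxr _ _)))).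
    by apply: NP; exact: leq_maxl.
  exists l => J zJJ; apply/ler_addgt0Pr => e e0; have [N NP] := lP e e0.
  have -> : l - (Q J).[z] = ((Q (J + N)).[z] - (Q J).[z]) + (l - (Q (J + N)).[z]) by ring.
  apply: (le_trans (normcD _ _)); apply: lerD; first exact: tail.
  by apply/ltW/NP; rewrite leq_addl.
have [f fP] := choice lim_ex.
have ef : hol f.
  apply: (@weierstrass _ (fun J z => (Q J).[z])) => [J|rho e e0]; first exact: hol_horner.
  have [N NP] := geo_lt 2 e0.
  have [N' N'P] := nat_above rho.
  exists (maxn N N') => J; rewrite geq_max => /andP[NJ N'J] z zr.
  rewrite normcB; apply: le_trans (ltW (NP J NJ)); apply: fP.
  by apply: (le_trans zr); apply: (le_trans N'P); rewrite ler_nat.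
exists f => //.
have iterQ i J z : iter (n i) T (fun z => (Q J).[z]) z = \sum_(j < J) (iter (n i) P (q j)).[z].
  rewrite iterLop_horner // /Q; elim: J => [|J IH].
    rewrite !big_ord0; have -> : iter (n i) P 0 = 0.
      by elim: (n i) => //= k ->; rewrite /P L_poly0 //.
    by rewrite horner0.
  by rewrite !big_ord_recr /= iterL_polyD // hornerD IH.
(* Partial sums are followed exactly; continuity of the (n i)-th iterate deals with
   the difference between f and a late partial sum. *)
have follow : forall i z, normc z <= i%:R ->
    normc (iter (n i) T f z - (target R i).[z]) <= 2 * 2^-1 ^+ i.
  move=> i z zi; have [K [rho' [K0 HK]]] := iterLop_bound ephi etphi lambda b (n i) i%:R.
  apply/ler_addgt0Pr => e e0.
  have [N NP] := geo_lt (K * 2) e0.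
  have [N' N'P] := nat_above rho'.
  pose J := maxn i.+1 (maxn N N').
  have iJ : (i < J)%N by rewrite leq_maxl.
  have NJ : (N <= J)%N by rewrite /J maxnCA leq_maxl.
  have N'J : (N' <= J)%N by rewrite /J maxnA leq_maxr.
  have eQ := hol_horner (Q J).
  have close : normc (iter (n i) T f z - iter (n i) T (fun z => (Q J).[z]) z) <= e.
    have ed : hol (fun z => (-1) * (Q J).[z] + f z) by exact: holZD.
    have := HK _ (2 * 2^-1 ^+ J) ed _ z zi.
    rewrite iterLopZD // mulN1r addrC => /(_ _)/wrap[y yr|].
      rewrite mulN1r addrC; apply: fP; apply: (le_trans yr); apply: (le_trans N'P).
      by rewrite ler_nat.
    by move/le_trans; apply; rewrite mulrA; exact/ltW/NP.
  have near : normc (iter (n i) T (fun z => (Q J).[z]) z - (target R i).[z]) <= 2 * 2^-1 ^+ i.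
    rewrite iterQ -qT.
    pose u j := if (j < i.+1)%N then 0 else (iter (n i) P (q j)).[z].
    have -> : \sum_(j < J) (iter (n i) P (q j)).[z] - (iter (n i) P (q i)).[z] =
        \sum_(j < J) u j.
      rewrite (bigD1 (Ordinal iJ)) //= addrAC subrr add0r [RHS](bigD1 (Ordinal iJ)) //=.
      rewrite /u ltnSn add0r; apply: eq_bigr => j ji.
      case: ifP => // ji'; rewrite q0 ?horner0 //.
      by rewrite ltn_neqAle -ltnS ji' andbT; apply: contra_neq ji => h; exact: val_inj.
    apply: normc_sum_geo => j; rewrite /u; first by move=> ->.
    move=> ij; rewrite ltnNge ij /=; apply: qsmall => //.
    by apply: (le_trans zi); rewrite ler_nat ltnW.
  have -> : iter (n i) T f z - (target R i).[z] =
    (iter (n i) T (fun z => (Q J).[z]) z - (target R i).[z]) +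
    (iter (n i) T f z - iter (n i) T (fun z => (Q J).[z]) z) by ring.
  by apply: (le_trans (normcD _ _)); exact: lerD.
move=> g rho e eg e0; have e3 : 0 < e / 3 by rewrite divr_gt0.
have [p pP] := hol_poly_approx rho eg e3.
have [s sP] := gauss_poly_approx p rho e3.
have [N NP] := geo_lt 2 e3.
have [N' N'P] := nat_above rho.
have [i + iT] := target_often R s (maxn N N'); rewrite geq_max => /andP[Ni N'i].
exists (n i) => z zr.
have zi : normc z <= i%:R by apply: (le_trans zr); apply: (le_trans N'P); rewrite ler_nat.
have h1 := pP z zr; have h2 := sP z zr; have h3 := follow i z zi; have h4 := NP i Ni.
rewrite iT in h3.
have -> : iter (n i) T f z - g z = (iter (n i) T f z - (gauss_poly R s).[z])
  - (p.[z] - (gauss_poly R s).[z]) - (g z - p.[z]) by ring.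
have := normcD (iter (n i) T f z - (gauss_poly R s).[z] - (p.[z] - (gauss_poly R s).[z]))
  (- (g z - p.[z])).
have := normcD (iter (n i) T f z - (gauss_poly R s).[z]) (- (p.[z] - (gauss_poly R s).[z])).
rewrite !normc_opp; lra.
Qed.

End Construction.

Unset Implicit Arguments.

Theorem theorem7 (R : realType) (phi : Cplx R -> Cplx R) (lambda b : Cplx R) :
  entire phi ->
  exponential_type phi ->
  ~ (exists c : Cplx R, forall z, phi z = c) ->
  phi 0 = 0 ->
  1 <= `|lambda| ->
  hypercyclic (L_op lambda b phi).
Proof.
move=> ephi et nc phi0 lam1; split; first exact: Lop_continuous_linear.
have ep : hol phi by exact/entire_hol.
have lam1' : 1 <= normc (lambda : R[i]) by move: lam1; rewrite norm_normc -(lecR 1).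
have exw : exists k, taylor_coef phi k != 0 :> R[i] by exact: taylor_coef_neq0.
pose m := ex_minn exw.
have [wm wmin] : taylor_coef phi m != 0 :> R[i] /\
    forall k, taylor_coef phi k != 0 :> R[i] -> (m <= k)%N.
  by rewrite /m; case: ex_minnP.
have wlt k : (k < m)%N -> taylor_coef phi k = 0.
  by move=> km; apply/eqP; apply: contraTT km => /wmin; rewrite leqNgt.
have m0 : (0 < m)%N.
  rewrite lt0n; apply: contra_neq wm => ->.
  by rewrite /taylor_coef /= phi0 mul0r.
have [f ef fP] := @hypercyclic_vector R phi lambda b ep et m m0 wlt wm lam1'.
exists f; first exact/entire_hol.
move=> g /entire_hol eg; apply: closure_disc_ball => rho e e0.
have [n nP] := fP g rho e eg e0.
by exists (iter n (L_op lambda b phi) f); [exists n | exact: nP].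
Qed.
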